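(* Let $T\ge 2$ be an integer and let $\mu>0$, $\sigma>0$, $-\frac{1}{T-1}<\rho<1$ satisfy $\mu^2+\rho\sigma^2>0$. Let $\gamma>0$ and let $$\mathrm{L}(\gamma)=\sup_{\mathbb P\in\mathcal P}\mathbb P\Big(\prod_{t=1}^T\tilde\xi_t\le\gamma\Big),$$ with the ambiguity set $\mathcal P$ defined in the context. If $T\ge 3$, then $\mathrm{L}(\gamma)$ coincides with the optimal objective value of the following semidefinite program: $$ \begin{aligned} \inf\ \ & \alpha + T\mu\beta + T(\mu^2+\sigma^2)\gamma_1 + T\left[T\mu^2+\sigma^2+(T-1)\rho\sigma^2\right]\gamma_2\\ \text{s.t.}\ \ & \alpha,\beta,\gamma_1,\gamma_2\in\mathbb R,\ \lambda_1,\lambda_2,\lambda_3\ge 0,\ \boldsymbol p\in\mathbb R^{2T+1},\ \boldsymbol P\in\mathbb S^{T+1}_+,\ \boldsymbol q\in\mathbb R^{2T-1},\ \boldsymbol Q\in\mathbb S^{T}_+\\ & \alpha\ge 1,\quad \gamma_1+\gamma_2\ge 0,\quad \gamma_1+T\gamma_2\ge 0\\ & \gamma_2+\tfrac{\gamma_1}{T}+\alpha\ \ge\ \left\Vert\left(\beta-\lambda_1,\ \gamma_2+\tfrac{\gamma_1}{T}-\alpha\right)\right\Vert_2\\ & \gamma_2+\gamma_1+\alpha-1\ \ge\ \left\Vert\left(\beta-\lambda_2,\ \gamma_2+\gamma_1-\alpha+1\right)\right\Vert_2\\ & \gamma_2+\tfrac{\gamma_1}{T}+\lambda_3+\alpha-1\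 \ge\ \left\Vert\left(\beta-\lambda_3T\gamma^{1/T},\ \gamma_2+\tfrac{\gamma_1}{T}+\lambda_3-\alpha+1\right)\right\Vert_2\\ & p_0=(T-1)\gamma_1\gamma^{\frac{2}{T-1}}+(T-1)^2\gamma_2\gamma^{\frac{2}{T-1}},\quad p_1+q_0=(T-1)\beta\gamma^{\frac{1}{T-1}}\\ & p_2+q_1=\alpha-1,\quad p_T+q_{T-1}=2(T-1)\gamma_2\gamma^{\frac{1}{T-1}},\quad p_{T+1}+q_T=\beta\\ & p_{2T}=\gamma_1+\gamma_2,\quad p_t+q_{t-1}=0\quad\forall t=3,\dots,T-1,\,T+2,\dots,2T-1\\ & p_t=\textstyle\sum_{i+j=t}P_{i,j}\quad\forall t=0,\dots,2T,\qquad q_t=\sum_{i+j=t}Q_{i,j}\quad\forall t=0,\dots,2T-2. \end{aligned} $$ If $T=2$, then $\mathrm{L}(\gamma)$ is given by the optimal objective value of the variant of this program in which the two constraints $p_2+q_1=\alpha-1$ and $p_T+q_{T-1}=2(T-1)\gamma_2\gamma^{\frac{1}{T-1}}$ are combined into the single constraint $p_2+q_1=\alpha-1+2(T-1)\gamma_2\gamma^{\frac{1}{T-1}}$.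
   Context: $\mathbb S^n$ is the space of symmetric real $n\times n$ matrices and $\mathbb S^n_+$ its subset of positive semidefinite matrices. The entries of $\boldsymbol p,\boldsymbol P,\boldsymbol q,\boldsymbol Q$ are numbered starting from $0$. Here $\gamma$ is a fixed number, whereas $\gamma_1,\gamma_2$ are decision variables. Let $\boldsymbol\mu=\mu\boldsymbol 1\in\mathbb R^T$ and $\boldsymbol\Sigma=(1-\rho)\sigma^2\mathbb I+\rho\sigma^2\boldsymbol 1\boldsymbol 1^\intercal\in\mathbb S^T$ (all variances equal $\sigma^2$, all pairwise correlations equal $\rho$), where $\mathbb I$ is the identity matrix and $\boldsymbol 1$ the all-ones vector. $\mathcal P$ is the set of all Borel probability distributions $\mathbb P$ of a random vector $\tilde{\boldsymbol\xi}=(\tilde\xi_1,\dots,\tilde\xi_T)^\intercal$ supported on $\mathbb R^T_+$ with $\mathbb E_{\mathbb P}(\tilde{\boldsymbol\xi})=\boldsymbol\mu$ and $\mathbb E_{\mathbb P}(\tilde{\boldsymbol\xi}\tilde{\boldsymbol\xi}^\intercal)=\boldsymbol\Sigma+\boldsymbol\mu\boldsymbol\mu^\intercal$. *)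

(* Defs.v *)
From HB Require Import structures.
From mathcomp Require Import all_boot all_order all_algebra.
From mathcomp Require Import all_classical all_reals all_analysis.

Set Implicit Arguments.
Unset Strict Implicit.
Unset Printing Implicit Defensive.

Import Order.TTheory GRing.Theory Num.Theory.
Import numFieldNormedType.Exports.

Local Open Scope classical_set_scope.
Local Open Scope ring_scope.

Section AmbiguitySet.
Context {R : realType}.

(* The library equips [n.-tuple] with the sigma-algebra generated by the
   coordinate projections, which is the Borel sigma-algebra of R^T. *)
Definition outcome (T : nat) := T.-tuple (measurableTypeR R).

Definition ones (T : nat) : 'cV[R]_T := const_mx 1.

Definition mean_vec (T : nat) (mu : R) : 'cV[R]_T := mu *: ones T.

Definition cov_mx (T : nat) (sigma rho : R) : 'M[R]_T :=
  ((1 - rho) * sigma ^+ 2) *: 1%:M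
  + (rho * sigma ^+ 2) *: (ones T *m (ones T)^T).

(* On the nonnegative orthant the integrands are nonnegative, so that the
   equalities below entail the finiteness of the first two moments. *)
Definition ambiguity_set (T : nat) (mu sigma rho : R) :
    set (probability (outcome T) R) :=
  [set P : probability (outcome T) R |
           [/\ P [set x : outcome T | forall i, 0 <= tnth x i] = 1%E,
               forall i, ('E_P[fun x => tnth x i] = (mean_vec T mu i 0)%:E)%E
             & forall i j, ('E_P[fun x => (tnth x i * tnth x j)%R] =
                 ((cov_mx T sigma rho
                   + mean_vec T mu *m (mean_vec T mu)^T) i j)%:E)%E]].
Arguments ambiguity_set T mu sigma rho : clear implicits.

Definition worst_case_prob (T : nat) (mu sigma rho gamma : R) : \bar R :=
  ereal_sup [set P [set x : outcome T | \prod_(t < T) tnth x t <= gamma]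
            | P in ambiguity_set T mu sigma rho].

End AmbiguitySet.
Arguments outcome R T : clear implicits.

Section SemidefiniteProgram.
Context {R : realType}.

Definition psd (n : nat) (A : 'M[R]_n) : Prop :=
  A^T = A /\ forall x : 'cV[R]_n, 0 <= (x^T *m A *m x) 0 0.

Definition l2norm2 (a b : R) : R := Num.sqrt (a ^+ 2 + b ^+ 2).

(* [sdp_q] has dimension 2T-1, written as a successor to allow [inord];
   this is only meaningful for T >= 1. *)
Record sdp_vars (T : nat) := SdpVars {
  sdp_alpha : R; sdp_beta : R; sdp_gamma1 : R; sdp_gamma2 : R;
  sdp_lambda1 : R; sdp_lambda2 : R; sdp_lambda3 : R;
  sdp_p : 'rV[R]_(2 * T).+1;
  sdp_P : 'M[R]_T.+1;
  sdp_q : 'rV[R]_(2 * T - 2).+1;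
  sdp_Q : 'M[R]_T }.

Definition entry (n : nat) (v : 'rV[R]_n.+1) (t : nat) : R := v 0 (inord t).

Definition antidiag_sum (n : nat) (A : 'M[R]_n) (t : nat) : R :=
  \sum_(i < n) \sum_(j < n | (i + j == t)%N) A i j.

Definition sdp_objective (T : nat) (mu sigma rho : R) (v : sdp_vars T) : R :=
  sdp_alpha v + T%:R * mu * sdp_beta v
  + T%:R * (mu ^+ 2 + sigma ^+ 2) * sdp_gamma1 v
  + T%:R * (T%:R * mu ^+ 2 + sigma ^+ 2 + (T%:R - 1) * rho * sigma ^+ 2)
    * sdp_gamma2 v.

(* The equations on [p] and [q] state that p(z) + z q(z) is z^2 times
     alpha - 1 + beta * sum_t x_t + gamma1 * sum_t x_t^2
       + gamma2 * (sum_t x_t)^2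
   along the curve of product gamma whose T-1 first coordinates are
   gamma^(1/(T-1)) / z and whose last one is z^(T-1).  The coefficients of
   z^2 and z^T are left out here: they are distinct for T >= 3
   ([sdp_feasible]) and coincide for T = 2 ([sdp_feasible_merged]). *)
Definition sdp_common (T : nat) (gamma : R) (v : sdp_vars T) : Prop :=
  let n : R := T%:R in
  let alpha := sdp_alpha v in
  let beta := sdp_beta v in
  let g1 := sdp_gamma1 v in
  let g2 := sdp_gamma2 v in
  let l1 := sdp_lambda1 v in
  let l2 := sdp_lambda2 v in
  let l3 := sdp_lambda3 v in
  let p := entry (sdp_p v) in
  let q := entry (sdp_q v) in
  [/\ [/\ 0 <= l1, 0 <= l2, 0 <= l3, psd (sdp_P v) & psd (sdp_Q v)],
      [/\ 1 <= alpha, 0 <= g1 + g2 & 0 <= g1 + n * g2],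
      [/\ l2norm2 (beta - l1) (g2 + g1 / n - alpha) <= g2 + g1 / n + alpha,
          l2norm2 (beta - l2) (g2 + g1 - alpha + 1) <= g2 + g1 + alpha - 1
        & l2norm2 (beta - l3 * n * gamma `^ n^-1)
                  (g2 + g1 / n + l3 - alpha + 1)
          <= g2 + g1 / n + l3 + alpha - 1],
      [/\ p 0%N = (n - 1) * g1 * gamma `^ (2 / (n - 1))
                  + (n - 1) ^+ 2 * g2 * gamma `^ (2 / (n - 1)),
          p 1%N + q 0%N = (n - 1) * beta * gamma `^ (n - 1)^-1,
          p (T + 1)%N + q T = beta,
          p (2 * T)%N = g1 + g2
        & forall t : nat,
            (3 <= t <= T - 1)%N || (T + 2 <= t <= 2 * T - 1)%N ->
            p t + q (t - 1)%N = 0]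
    & (forall t : nat, (t <= 2 * T)%N -> p t = antidiag_sum (sdp_P v) t) /\
      (forall t : nat, (t <= 2 * T - 2)%N -> q t = antidiag_sum (sdp_Q v) t)].

Definition sdp_feasible (T : nat) (gamma : R) : set (sdp_vars T) :=
  [set v | let p := entry (sdp_p v) in
           let q := entry (sdp_q v) in
           [/\ sdp_common gamma v,
               p 2%N + q 1%N = sdp_alpha v - 1
             & p T + q (T - 1)%N =
               2 * (T%:R - 1) * sdp_gamma2 v * gamma `^ (T%:R - 1)^-1]].

Definition sdp_feasible_merged (T : nat) (gamma : R) : set (sdp_vars T) :=
  [set v | let p := entry (sdp_p v) in
           let q := entry (sdp_q v) in
           sdp_common gamma v /\
           p 2%N + q 1%N =
             sdp_alpha v - 1
             + 2 * (T%:R - 1) * sdp_gamma2 v * gamma `^ (T%:R - 1)^-1].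

Definition sdp_value (T : nat) (mu sigma rho : R)
    (F : set (sdp_vars T)) : \bar R :=
  ereal_inf [set (sdp_objective mu sigma rho v)%:E | v in F].

End SemidefiniteProgram.

(* Main.v *)
Require Import Defs.
From HB Require Import structures.
From mathcomp Require Import all_boot all_order all_algebra.
From mathcomp Require Import fingroup perm polyrcf.
From mathcomp Require Import all_classical all_reals all_analysis.
From mathcomp Require Import measurable_realfun.
From mathcomp Require Import ring lra zify.

Set Implicit Arguments.
Unset Strict Implicit.
Unset Printing Implicit Defensive.

Import Order.TTheory GRing.Theory Num.Theory.
Import numFieldNormedType.Exports.

Local Open Scope classical_set_scope.
Local Open Scope ring_scope.

(* The worst-case probability and its moment dual are invariant under
   permutations of the coordinates, so the dual variables are a quadratic
   h(x) = alpha + beta s + gamma1 n + gamma2 s^2 in s = sum x, n = sum x^2,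
   required to satisfy h >= 0 on the orthant and h >= 1 where prod x <= gamma.
   Strong duality holds because the moments (E s, E n, E s^2) are interior: a
   hyperplane separates the attainable moments and probabilities of finitely
   supported measures from any value above the supremum, and symmetrizing a
   finitely supported measure puts it into the ambiguity set.
   For fixed s the number n ranges over [s^2 / T, s^2] on the orthant, and h is
   affine in n; this gives three quadratic inequalities in s, on a half-line or
   a segment, which are the second-order cone constraints.  The remaining case
   is s > T gamma^(1/T) and gamma1 >= 0, where n is to be minimized subject to
   prod x <= gamma: a minimizer has product gamma and all coordinates equal but
   one, hence lies on a rational curve, along which the constraint says that a
   polynomial is nonnegative on the half-line, i.e. is of the form p + X q with
   p and q sums of squares; P and Q are the Gram matrices of p and q. *)

(** * Quadratics and second-order cones *)

Section Quadratics.
Context {R : realType}.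
Implicit Types a b c K l s : R.

(** Squaring leaves [b ^+ 2 <= 4 * a * c], because [(c + a) ^+ 2 - (c - a) ^+ 2 = 4 * a * c]: the
    constraint is a rotated second-order cone. *)
Lemma l2norm2_leP a b c :
  (l2norm2 b (c - a) <= c + a) <-> [/\ 0 <= a, 0 <= c & b ^+ 2 <= 4 * a * c].
Proof.
rewrite /l2norm2; split.
- move=> H; have ac0 : 0 <= c + a by apply: le_trans H; rewrite sqrtr_ge0.
  have : b ^+ 2 + (c - a) ^+ 2 <= (c + a) ^+ 2.
    rewrite -[X in X <= _]sqr_sqrtr ?addr_ge0 ?sqr_ge0//.
    by rewrite ler_sqr ?nnegrE ?sqrtr_ge0.
  have b2 := sqr_ge0 b.
  move=> H2; have ac : 0 <= a * c by nra.
  by split; nra.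
- move=> [a0 c0 H]; rewrite -[leRHS]ger0_norm ?addr_ge0// -sqrtr_sqr.
  by rewrite ler_sqrt ?sqr_ge0//; nra.
Qed.

(** Completing the square: [4 c (a + b s + c s^2) = (2 c s + b)^2 + (4 a c - b^2)]. If [c = 0], the
    discriminant condition forces [b = 0]. *)
Lemma quad_discr_ge0 a b c s :
  0 <= a -> 0 <= c -> b ^+ 2 <= 4 * a * c -> 0 <= a + b * s + c * s ^+ 2.
Proof.
move=> a0 c0 H; have [c00|cn0] := eqVneq c 0.
  have b0 : b = 0.
    by apply/eqP; rewrite -sqrf_eq0 eq_le sqr_ge0 andbT; move: H; rewrite c00 mulr0.
  by rewrite b0 c00 !mul0r !addr0.
have cp : 0 < c by rewrite lt_def cn0.
have : 0 <= 4 * c * (a + b * s + c * s ^+ 2).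
  have := sqr_ge0 (2 * c * s + b); nra.
by rewrite pmulr_rge0// mulr_gt0.
Qed.

(** [l] is the multiplier of the constraint [s >= 0]: once [l * s] is subtracted, the quadratic is
    nonnegative on the whole line. The multiplier is [b] if [b >= 0] and [0] otherwise. *)
Lemma quad_ge0_halflineP a b c :
  (exists2 l, 0 <= l & [/\ 0 <= a, 0 <= c & (b - l) ^+ 2 <= 4 * a * c]) <->
  (forall s, 0 <= s -> 0 <= a + b * s + c * s ^+ 2).
Proof.
split=> [[l l0 [a0 c0 H]] s s0|H].
  have := quad_discr_ge0 s a0 c0 H.
  have : 0 <= l * s by rewrite mulr_ge0.
  by nra.
have a0 : 0 <= a by have := H 0 (lexx _); rewrite expr2 !mulr0 !addr0.
have [c0|c0] := leP 0 c; last first.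
  (* With [- c * s = - c + a + |b|] and [s >= 1], the value at [s] is at most
     [a (1 - s) + c s < 0]. *)
  pose s := 1 + (a + `|b|) / (- c).
  have nc0 : 0 < - c by rewrite oppr_gt0.
  have q0 : 0 <= (a + `|b|) / - c by rewrite divr_ge0 ?addr_ge0// ltW.
  have s1 : 1 <= s by rewrite lerDl.
  have E : - c * s = - c + a + `|b| by rewrite /s mulrDr mulr1 mulrCA divff ?mulr1 ?addrA// gt_eqF.
  have := H s (le_trans ler01 s1).
  have : b * s <= `|b| * s by rewrite ler_wpM2r ?ler_norm// (le_trans ler01).
  have : a <= a * s by rewrite ler_peMr.
  by nra.
have [b0|b0] := leP 0 b.
  by exists b => //; split=> //; rewrite subrr expr0n/=; nra.
exists 0 => //; rewrite subr0; split=> //.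
have [c00|cn0] := eqVneq c 0.
  pose s := (a + 1) / (- b).
  have nb0 : 0 < - b by rewrite oppr_gt0.
  have s0 : 0 <= s by rewrite divr_ge0 ?addr_ge0// ltW.
  have E : - b * s = a + 1 by rewrite /s mulrCA divff ?mulr1// gt_eqF.
  by have := H s s0; rewrite c00; nra.
have cp : 0 < c by rewrite lt_def cn0.
(* At the vertex, nonnegativity of the quadratic is the discriminant inequality. *)
pose s := - b / (2 * c).
have s0 : 0 <= s by rewrite divr_ge0 ?oppr_ge0// ltW// mulr_gt0.
have E : 2 * c * s = - b by rewrite /s mulrCA divff ?mulr1// mulf_neq0 ?pnatr_eq0.
have : 0 <= 4 * c * (a + b * s + c * s ^+ 2).
  by rewrite mulr_ge0 ?H// ltW// mulr_gt0.
by nra.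
Qed.

(** [l] is the multiplier of [s * (K - s) >= 0], the inequality that describes the segment. In the
    forward direction the remainder has discriminant at most zero; in the converse it is chosen to
    be a perfect square. *)
Lemma quad_ge0_segmentP a b c K : 0 < K ->
  (exists2 l, 0 <= l &
    [/\ 0 <= a, 0 <= c + l & (b - l * K) ^+ 2 <= 4 * a * (c + l)]) <->
  (forall s, 0 <= s <= K -> 0 <= a + b * s + c * s ^+ 2).
Proof.
move=> K0; split=> [[l l0 [a0 c0 H]] s /andP[s0 sK]|H].
  have := quad_discr_ge0 s a0 c0 H.
  have : 0 <= l * (s * (K - s)) by rewrite !mulr_ge0// subr_ge0.
  by nra.
have K0' := ltW K0.
have a0 : 0 <= a.
  by have := H 0; rewrite lexx K0' expr2 !mulr0 !addr0; exact.
have FK0 : 0 <= a + b * K + c * K ^+ 2 by apply: H; rewrite K0' lexx.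
have Kn0 : K != 0 by rewrite gt_eqF.
pose u := Num.sqrt a; pose w := Num.sqrt (a + b * K + c * K ^+ 2).
have u0 : 0 <= u by rewrite sqrtr_ge0.
have w0 : 0 <= w by rewrite sqrtr_ge0.
have uE : a = u ^+ 2 by rewrite sqr_sqrtr.
have wE : b = (w ^+ 2 - u ^+ 2) / K - c * K.
  by rewrite !sqr_sqrtr//; field.
pose l := (u + w) ^+ 2 / K ^+ 2 - c.
(* [a + b s + c s^2 = (u - (u + w) s / K)^2 + l s (K - s)]: the square
   interpolates the left-hand side at [0] and [K]. *)
have FE s : a + b * s + c * s ^+ 2 =
    (u - (u + w) * s / K) ^+ 2 + l * (s * (K - s)).
  by rewrite uE wE /l; field.
have l0 : 0 <= l.
  (* If [l < 0], the last term of [FE] is negative inside the segment, so it suffices to make the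
     square zero or small there. The square is identically zero if [u = w = 0], vanishes at an
     endpoint if exactly one of them is zero, and vanishes at the interior point [u K / (u + w)]
     otherwise. *)
  rewrite leNgt; apply/negP => l0.
  have [uw|uw] := eqVneq (u + w) 0.
    have [u00 w00] : u = 0 /\ w = 0 by split; lra.
    have := H (K / 2); rewrite FE uw u00 mul0r mul0r subrr expr0n/= add0r.
    have -> : K / 2 * (K - K / 2) = (K / 2) ^+ 2 by field.
    have : 0 < (K / 2) ^+ 2 by rewrite exprn_gt0// divr_gt0.
    move=> ? H'; have : 0 <= l * (K / 2) ^+ 2 by apply: H'; apply/andP; split; lra.
    by nra.
  have uwp : 0 < u + w by rewrite lt_def uw addr_ge0.
  have main s : 0 < s < K -> l * (s * (K - s)) < 0.
    by move=> /andP[? ?]; rewrite nmulr_rlt0// mulr_gt0// subr_gt0.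
  (* [r] is half the positive root of [e r^2 + l r (K - r)], where [e = v^2 / K^2]; the value at [r]
     is [r l K / 2 < 0]. *)
  have small v : 0 < v -> let r := - l * K / (v ^+ 2 / K ^+ 2 - l) / 2 in
      [/\ 0 < r, r < K & v ^+ 2 / K ^+ 2 * r ^+ 2 + l * (r * (K - r)) < 0].
    move=> v0 r; set e := v ^+ 2 / K ^+ 2 in r *.
    have e0 : 0 < e by rewrite divr_gt0// exprn_gt0.
    have el0 : 0 < e - l by rewrite subr_gt0 (lt_trans l0).
    have rE : r * (e - l) = - l * K / 2.
      by rewrite /r; field; rewrite gt_eqF.
    have r0 : 0 < r by rewrite !divr_gt0// mulr_gt0// oppr_gt0.
    have rK : r < K.
      rewrite -(ltr_pM2r el0) rE; have : 0 < K * e by rewrite mulr_gt0.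
      have : l * K < 0 by rewrite nmulr_rlt0.
      by lra.
    split=> //; rewrite [X in X < 0](_ : _ = r * (r * (e - l) + l * K)); last by ring.
    have lK : l * K < 0 by rewrite nmulr_rlt0.
    by rewrite rE pmulr_rlt0//; lra.
  have [u00|un0] := eqVneq u 0.
    have wp : 0 < w by move: uwp; rewrite u00 add0r.
    have [] := small w wp; set r := _ / 2 => r0 rK.
    apply/negP; rewrite -leNgt; have := H r; rewrite FE u00 (ltW r0) (ltW rK) !add0r.
    by rewrite (_ : (- _) ^+ 2 = w ^+ 2 / K ^+ 2 * r ^+ 2); [exact|field].
  have up : 0 < u by rewrite lt_def un0.
  have [w00|wn0] := eqVneq w 0.
    have [] := small u up; set r := _ / 2 => r0 rK.
    apply/negP; rewrite -leNgt; have := H (K - r).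
    rewrite FE w00 addr0 (_ : u - u * (K - r) / K = u * r / K); last by field.
    rewrite subKr [(K - r) * r]mulrC.
    rewrite (_ : (u * r / K) ^+ 2 = u ^+ 2 / K ^+ 2 * r ^+ 2); last by field.
    apply.
    by rewrite subr_ge0 lerBlDr lerDl !ltW.
  have wp : 0 < w by rewrite lt_def wn0.
  have s0 : 0 < u * K / (u + w) by rewrite divr_gt0// mulr_gt0.
  have sK : u * K / (u + w) < K by rewrite ltr_pdivrMr// mulrC ltr_pM2l// ltrDl.
  have := main _ (introT andP (conj s0 sK)).
  apply/negP; rewrite -leNgt; have := H (u * K / (u + w)).
  rewrite FE (_ : u - _ = 0); last by field; rewrite uw Kn0.
  by rewrite expr0n add0r (ltW s0) (ltW sK); exact.
exists l => //; split=> //.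
  by rewrite /l addrC subrK divr_ge0 ?sqr_ge0.
rewrite (_ : c + l = (u + w) ^+ 2 / K ^+ 2); last by rewrite /l addrC subrK.
rewrite (_ : b - l * K = - (2 * u * (u + w) / K)); last by rewrite wE /l; field.
by rewrite uE le_eqVlt; apply/orP; left; apply/eqP; field.
Qed.

End Quadratics.

(** * Polynomials nonnegative on a half-line *)

Section HalfLine.
Context {R : realType}.
Implicit Types F G H : {poly R}.

(** By continuity, a negative value at [r] would persist slightly to the right of [r]. *)
Lemma horner_ge0_closure F (r : R) (a : R) : a <= r ->
  (forall x, a <= x -> x != r -> 0 <= F.[x]) -> 0 <= F.[r].
Proof.
move=> ar H; rewrite leNgt; apply/negP => F0.
have nF0 : 0 < - F.[r] by rewrite oppr_gt0.
have [d d0 Hd] := poly_cont r F nF0.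
have : `|(r + d / 2) - r| < d by rewrite addrAC subrr add0r gtr0_norm; lra.
move=> /Hd; have := H (r + d / 2).
rewrite -subr_eq0 addrAC subrr add0r gt_eqF ?divr_gt0// => /(_ _ isT) F1.
by rewrite gtr0_norm; have := F1; lra.
Qed.

(** Write [F = F(0) + X G]. If [G] is nonzero it shares the positive leading coefficient of [F], so
    [F >= F(0)] beyond some [M], and a minimum over [[0, M]] is a minimum over the half-line. *)
Lemma nonneg_halfline_attains_min F :
  (forall x, 0 <= x -> 0 <= F.[x]) ->
  exists2 r, 0 <= r & forall x, 0 <= x -> F.[r] <= F.[x].
Proof.
move=> F0; have [->|Fn0] := eqVneq F 0.
  by exists 0 => // x _; rewrite !horner0.
have lc0 : 0 < lead_coef F.
  rewrite lt_def lead_coef_eq0 Fn0 leNgt; apply/negP => lc.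
  have [|M HM] := @poly_pinfty_gt_lc _ (- F); first by rewrite lead_coefN oppr_gt0.
  have := HM (Num.max M 0); rewrite le_max lexx => /(_ isT).
  have := F0 (Num.max M 0); rewrite le_max lexx orbT => /(_ isT).
  by rewrite lead_coefN hornerN; lra.
have [M M0 HM] : exists2 M, 0 <= M & forall x, M <= x -> F.[0] <= F.[x].
  have : root (F - F.[0]%:P) 0 by rewrite rootE !hornerE subrr.
  move=> /factor_theorem[G]; rewrite subr0 => FE.
  have {}FE : F = G * 'X + F.[0]%:P by rewrite -FE subrK.
  have [G0|Gn0] := eqVneq G 0.
    by exists 0 => // x _; rewrite [leRHS](_ : _ = F.[0])// FE G0 !hornerE.
  have lcG : lead_coef G = lead_coef F.
    rewrite [in RHS]FE lead_coefDl ?lead_coefMX// size_mulX//.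
    by rewrite (leq_ltn_trans (size_polyC_leq1 _))// ltnS lt0n size_poly_eq0.
  have [|M HM] := @poly_pinfty_gt_lc _ G; first by rewrite lcG.
  exists (Num.max M 0); first by rewrite le_max lexx orbT.
  move=> x; rewrite ge_max => /andP[Mx x0].
  rewrite [leRHS](_ : _ = G.[x] * x + F.[0]); last by rewrite {1}FE !hornerE.
  by rewrite lerDr mulr_ge0// (le_trans _ (HM _ Mx))// lcG ltW.
have cF : {within `[0, M], continuous (horner F)}.
  by apply: continuous_subspaceT => x; exact: continuous_horner.
have [r] := @EVT_min R (horner F) 0 M M0 cF.
rewrite in_itv => /andP[r0 rM] Hr; exists r => // x x0.
have [xM|/ltW/HM] := leP x M; first by apply: Hr; rewrite in_itv /= x0.
by apply: le_trans; apply: Hr; rewrite in_itv /= lexx.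
Qed.

(* [n] bounds the degree of every summand [a^2] and [X * b^2]. *)
Definition halfline_sos (n : nat) F : Prop :=
  exists2 ab : seq {poly R} * seq {poly R},
    (forall a, a \in ab.1 -> ((size a).-1.*2 <= n)%N) /\
    (forall b, b \in ab.2 -> b != 0 -> ((size b).-1.*2.+1 <= n)%N) &
    F = \sum_(a <- ab.1) a ^+ 2 + 'X * \sum_(b <- ab.2) b ^+ 2.

Lemma halfline_sosD n m F G : (m <= n)%N ->
  halfline_sos m F -> halfline_sos n G -> halfline_sos n (F + G).
Proof.
move=> mn [[a b]/= [Ha Hb] ->] [[a' b']/= [Ha' Hb'] ->].
exists (a ++ a', b ++ b') => /=; last by rewrite !big_cat/=; ring.
split=> c; rewrite mem_cat => /orP[].
- by move=> /Ha /leq_trans; apply.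
- exact: Ha'.
- by move=> /Hb h /h /leq_trans; apply.
- exact: Hb'.
Qed.

Lemma halfline_sosC (c : R) : 0 <= c -> halfline_sos 0 c%:P.
Proof.
move=> c0; exists ([:: (Num.sqrt c)%:P], [::]) => /=.
  by split=> // a; rewrite inE => /eqP ->; rewrite size_polyC; case: eqP.
by rewrite big_seq1 big_nil mulr0 addr0 -polyC_exp sqr_sqrtr.
Qed.

(** The two families trade places: [X * (X * b^2) = (X b)^2], while [X * a^2] already has the second
    form. *)
Lemma halfline_sosMX n F : halfline_sos n F -> halfline_sos n.+1 ('X * F).
Proof.
move=> [[a b]/= [Ha Hb] ->]; exists ([seq 'X * c | c <- b], a) => /=.
  split=> c; last by move=> /Ha; rewrite ltnS.
  move=> /mapP[d /Hb Hd ->]; rewrite mulrC.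
  have [->|dn0] := eqVneq d 0; first by rewrite mul0r size_poly0.
  rewrite size_mulX//=; move: (Hd dn0); have := size_poly_eq0 d.
  by rewrite (negbTE dn0); lia.
rewrite big_map mulrDr addrC; congr (_ + _); rewrite mulrA -expr2 big_distrr/=.
by apply: eq_bigr => c _; rewrite exprMn.
Qed.

Lemma halfline_sosM_sqrXsubC n F (r : R) :
  halfline_sos n F -> halfline_sos n.+2 (('X - r%:P) ^+ 2 * F).
Proof.
move=> [[a b]/= [Ha Hb] ->].
have szM (c : {poly R}) : c != 0 -> size (('X - r%:P) * c) = (size c).+1.
  by move=> c0; rewrite mulrC size_Mmonic ?monicXsubC// size_XsubC addn2.
exists ([seq ('X - r%:P) * c | c <- a], [seq ('X - r%:P) * c | c <- b]) => /=.
  split=> c /mapP[d dab ->].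
    have [->|dn0] := eqVneq d 0; first by rewrite mulr0 size_poly0.
    rewrite szM//=; move: (Ha _ dab); have := size_poly_eq0 d.
    by rewrite (negbTE dn0); lia.
  have [->|dn0 _] := eqVneq d 0; first by rewrite mulr0 eqxx.
  rewrite szM//=; move: (Hb _ dab dn0); have := size_poly_eq0 d.
  by rewrite (negbTE dn0); lia.
rewrite !big_map mulrDr [_ * ('X * _)]mulrCA !big_distrr/=.
congr (_ + _); first by apply: eq_bigr => c _; rewrite exprMn.
by apply: eq_bigr => c _; rewrite exprMn.
Qed.

(* Subtracting the minimum [m] of [F] over the half-line, attained at [r],
   makes [F - m] divisible by [X] (if [r = 0]) or [(X - r)^2] (if [r > 0])
   with a quotient that is again nonnegative on the half-line. *)
Lemma nonneg_halfline_sos n F : (size F <= n.+1)%N ->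
  (forall x, 0 <= x -> 0 <= F.[x]) -> halfline_sos n F.
Proof.
elim/ltn_ind: n F => n IH F sF F0.
have [r r0 Hr] := nonneg_halfline_attains_min F0.
have m0 : 0 <= F.[r] by apply: F0.
have : root (F - F.[r]%:P) r by rewrite rootE !hornerE subrr.
move=> /factor_theorem[G FE].
have FE' : F = F.[r]%:P + G * ('X - r%:P) by rewrite -FE addrC subrK.
have Fx x : F.[x] - F.[r] = G.[x] * (x - r).
  by have := congr1 (horner^~ x) FE; rewrite !hornerE.
have [G0|Gn0] := eqVneq G 0.
  rewrite FE' G0 mul0r addr0; have := halfline_sosC m0.
  move=> /(@halfline_sosD n 0 _ 0 (leq0n _)); rewrite addr0; apply.
  by exists ([::], [::]) => //=; rewrite !big_nil mulr0 addr0.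
have sG : (size G < size F)%N.
  rewrite FE' addrC size_polyDl size_Mmonic ?monicXsubC// size_XsubC addn2//=.
  by rewrite (leq_ltn_trans (size_polyC_leq1 _))// ltnS lt0n size_poly_eq0.
have n0 : (0 < n)%N.
  by rewrite lt0n; apply/eqP => n0; move: sF sG Gn0; rewrite n0 -size_poly_eq0; lia.
have sGn : (size G <= n)%N by rewrite -ltnS (leq_trans sG).
have Gr x : 0 <= x -> r < x -> 0 <= G.[x].
  move=> x0 rx; rewrite -(@pmulr_lge0 _ (x - r)) ?subr_gt0// -Fx subr_ge0.
  exact: Hr.
have [r00|rn0] := eqVneq r 0.
  rewrite FE' r00 subr0 mulrC; case: n n0 sGn IH sF => // n _ sGn IH sF.
  apply: (@halfline_sosD n.+1 0) => //; first by rewrite -r00; exact: halfline_sosC.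
  apply: halfline_sosMX; apply: IH => // x x0.
  have [->|xn0] := eqVneq x 0; last by apply: Gr => //; rewrite r00 lt_def xn0.
  apply: (@horner_ge0_closure _ _ 0) => // y y0 yn0.
  by apply: Gr => //; rewrite r00 lt_def yn0.
have rp : 0 < r by rewrite lt_def rn0.
have Gr' x : 0 <= x -> x < r -> G.[x] <= 0.
  move=> x0 xr; rewrite -(@nmulr_lge0 _ (x - r)) ?subr_lt0// -Fx subr_ge0.
  exact: Hr.
(* [G] is nonpositive to the left of the interior minimizer and nonnegative to its right, so it
   vanishes there and [r] is a double root of [F - F(r)]. *)
have Grr : G.[r] = 0.
  apply/eqP; rewrite eq_le; apply/andP; split.
    rewrite leNgt; apply/negP => Grp.
    have [d d0 Hd] := poly_cont r G Grp.
    pose y := r - Num.min (d / 2) r.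
    have y0 : 0 <= y by rewrite subr_ge0 ge_min lexx orbT.
    have mp : 0 < Num.min (d / 2) r by rewrite lt_min rp divr_gt0.
    have yr : y < r by rewrite ltrBlDr ltrDl.
    have := Gr' _ y0 yr; have : `|y - r| < d.
      rewrite /y addrAC subrr sub0r normrN gtr0_norm//.
      by rewrite gt_min; apply/orP; left; lra.
    by move=> /Hd; rewrite ltr_norml => /andP[? ?]; lra.
  apply: (@horner_ge0_closure _ _ r) => // y ry yn.
  by apply: Gr; rewrite ?lt_def ?yn// (le_trans r0).
have : root G r by rewrite rootE Grr.
move=> /factor_theorem[H GE].
have Hn0 : H != 0 by apply: contra_neq Gn0 => H0; rewrite GE H0 mul0r.
have sH : (size G = (size H).+1)%N.
  by rewrite GE size_Mmonic ?monicXsubC// size_XsubC addn2.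
have H0 x : 0 <= x -> 0 <= H.[x].
  move=> x0; have Gx y : G.[y] = H.[y] * (y - r) by rewrite GE !hornerE.
  have aux y : 0 <= y -> y != r -> 0 <= H.[y].
    move=> y0; rewrite neq_lt => /orP[yr|ry].
      by rewrite -(@nmulr_lle0 _ (y - r)) ?subr_lt0// -Gx Gr'.
    by rewrite -(@pmulr_lge0 _ (y - r)) ?subr_gt0// -Gx Gr.
  have [->|] := eqVneq x r; last exact: aux.
  exact: (@horner_ge0_closure _ _ 0).
case: n n0 sGn IH sF => // -[|n] _ sGn IH sF.
  by move: Hn0; rewrite -size_poly_eq0; move: sGn; rewrite sH; case: (size H).
rewrite FE' GE -mulrA -expr2 mulrC.
apply: (@halfline_sosD n.+2 0) => //; first exact: halfline_sosC.
apply: halfline_sosM_sqrXsubC; apply: IH => //.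
by rewrite -ltnS -sH.
Qed.

End HalfLine.

(** * Equal variables minimize the sum of squares *)

Section EqualVariable.
Context {R : realType}.

(* With [t := p - d] the triple [(t, q', r')] keeps the first two elementary
   symmetric functions, so [t q' r' - p q r = (t - p) (t - q) (t - r) < 0]. *)
Lemma decrease_triple_product (p q r : R) : 0 < p -> p <= q -> q < r ->
  exists p' q' r', [/\ [/\ 0 <= p', 0 <= q' & 0 <= r'],
    p' + q' + r' = p + q + r,
    p' ^+ 2 + q' ^+ 2 + r' ^+ 2 = p ^+ 2 + q ^+ 2 + r ^+ 2
    & p' * q' * r' < p * q * r].
Proof.
move=> p0 pq qr; have r0 : 0 < r by lra.
(* The new [q'] and [r'] are the roots of [X^2 - S X + M], with discriminant
   [(r - q)^2 - 2 d (q + r) + 4 d p - 3 d^2]. Since [d <= p <= q < r], the negative terms amount to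
   at most [7 r d], so the roots are real; [d <= p] keeps [p - d] nonnegative. *)
pose d := Num.min p ((r - q) ^+ 2 / (7 * r)).
have d0 : 0 < d.
  by rewrite lt_min p0 divr_gt0 ?mulr_gt0 ?exprn_gt0 ?subr_gt0.
have dp : d <= p by rewrite ge_min lexx.
have dr : 7 * r * d <= (r - q) ^+ 2.
  rewrite mulrC -ler_pdivlMr ?mulr_gt0//.
  by rewrite ge_min lexx orbT.
pose S := q + r + d; pose M := q * r + d * (q + r - p) + d ^+ 2.
have S0 : 0 < S by rewrite /S; lra.
have M0 : 0 <= M by rewrite /M; nra.
have D0 : 0 <= S ^+ 2 - 4 * M by rewrite /S /M; nra.
pose w := Num.sqrt (S ^+ 2 - 4 * M).
have w0 : 0 <= w by rewrite sqrtr_ge0.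
have wE : w ^+ 2 = S ^+ 2 - 4 * M by rewrite sqr_sqrtr.
have wS : w <= S by rewrite -ler_sqr ?nnegrE ?wE//; [lra|exact: ltW].
exists (p - d), ((S - w) / 2), ((S + w) / 2).
have prodE : (S - w) / 2 * ((S + w) / 2) = M.
  transitivity ((S ^+ 2 - w ^+ 2) / 4); first by field.
  by rewrite wE; field.
split.
- by split; [rewrite subr_ge0|lra|lra].
- by rewrite /S; field.
- transitivity ((p - d) ^+ 2 + ((S ^+ 2 + w ^+ 2) / 2)); first by field.
  by rewrite wE /S /M; field.
- rewrite -mulrA prodE -subr_lt0.
  rewrite [X in X < 0](_ : _ = - (d * ((q - p + d) * (r - p + d)))); last first.
    by rewrite /M; ring.
  by rewrite oppr_lt0; apply: mulr_gt0 => //; apply: mulr_gt0; lra.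
Qed.

Lemma sum_sqr_ge (T : nat) (x : 'I_T -> R) :
  (\sum_i x i) ^+ 2 <= T%:R * \sum_i x i ^+ 2.
Proof.
have [T0|T0] := eqVneq T 0%N; first by subst T; rewrite !big_ord0 expr0n mulr0.
pose m := (\sum_i x i) / T%:R.
have T0' : T%:R != 0 :> R by rewrite pnatr_eq0.
have : 0 <= \sum_i (x i - m) ^+ 2 by apply: sumr_ge0 => i _; exact: sqr_ge0.
have -> : \sum_i (x i - m) ^+ 2 = \sum_i x i ^+ 2 - (\sum_i x i) ^+ 2 / T%:R.
  rewrite (eq_bigr (fun i => x i ^+ 2 - 2 * m * x i + m ^+ 2)); last first.
    by move=> i _; ring.
  rewrite !big_split/= sumrN -mulr_sumr sumr_const card_ord -mulr_natl.
  by rewrite /m; field.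
by rewrite subr_ge0 ler_pdivrMr ?ltr0n ?lt0n// mulrC.
Qed.


Lemma continuous_bigop (U : topologicalType) (I : Type) (r : seq I)
    (op : R -> R -> R) (idx : R) (g : I -> U -> R) :
  (forall f h : U -> R, continuous f -> continuous h ->
     continuous (fun v => op (f v) (h v))) ->
  (forall i, continuous (g i)) ->
  continuous (fun v => \big[op/idx]_(i <- r) g i v).
Proof.
move=> cop cg; elim: r => [|i r IH].
  rewrite (_ : (fun _ => _) = cst idx); first exact: cst_continuous.
  by apply/funext => v; rewrite big_nil.
rewrite (_ : (fun _ => _) = fun v => op (g i v) (\big[op/idx]_(i <- r) g i v)).
  exact: cop.
by apply/funext => v; rewrite big_cons.
Qed.

Lemma continuous_sum (U : topologicalType) (I : Type) (r : seq I)
    (g : I -> U -> R) : (forall i, continuous (g i)) ->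
  continuous (fun v => \sum_(i <- r) g i v).
Proof. by apply: continuous_bigop => f h cf ch v; apply: cvgD; [exact: cf|exact: ch]. Qed.

Lemma continuous_prod (U : topologicalType) (I : Type) (r : seq I)
    (g : I -> U -> R) : (forall i, continuous (g i)) ->
  continuous (fun v => \prod_(i <- r) g i v).
Proof. by apply: continuous_bigop => f h cf ch v; apply: cvgM; [exact: cf|exact: ch]. Qed.

Definition prod_le_simplex (T : nat) (s g : R) (x : 'I_T -> R) : Prop :=
  [/\ forall i, 0 <= x i, \sum_i x i = s & \prod_i x i <= g].

(** The constraints cut a closed subset out of the cube [[0, s]^T]. Points are moved to row vectors,
    where compactness is available. *)
Lemma min_sum_sqr_attained (T : nat) (s g : R) (x : 'I_T -> R) :
  prod_le_simplex s g x ->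
  exists2 y : 'I_T -> R, prod_le_simplex s g y &
    forall z : 'I_T -> R, prod_le_simplex s g z -> \sum_i y i ^+ 2 <= \sum_i z i ^+ 2.
Proof.
move=> Fx; pose A := [set v : 'rV[R]_T | prod_le_simplex s g (v 0)].
have Amx (y : 'I_T -> R) : prod_le_simplex s g y ->
    (\row_i y i : 'rV[R]_T) \in A.
  move=> [y0 ys yg]; rewrite inE; split.
  - by move=> i; rewrite mxE.
  - by rewrite -ys; apply: eq_bigr => i _; rewrite mxE.
  - by apply: le_trans yg; rewrite le_eqVlt; apply/orP; left; apply/eqP;
      apply: eq_bigr => i _; rewrite mxE.
have cc (i : 'I_T) : continuous (fun v : 'rV[R]_T => v 0 i).
  exact: coord_continuous.
have cA : compact A.
  have cB : compact [set v : 'rV[R]_T | forall i, `[0, s]%classic (v ord0 i)].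
    by apply: (@rV_compact _ _ (fun=> `[0, s]%classic)) => _; exact: segment_compact.
  apply: (subclosed_compact _ cB).
    have -> : A = \bigcap_(i : 'I_T) ((fun v : 'rV[R]_T => v 0 i) @^-1` [set t | 0 <= t])
        `&` ((fun v : 'rV[R]_T => \sum_i v 0 i) @^-1` [set t | t = s])
        `&` ((fun v : 'rV[R]_T => \prod_i v 0 i) @^-1` [set t | t <= g]).
      apply/seteqP; split=> v /=; first move=> [v0 vs vg].
        by split; first split; [move=> i _; exact: v0| |].
      by move=> [[v0 ? ?]]; split=> // i; exact: v0.
    apply: closedI; first apply: closedI.
    - by apply: closed_bigI => i _;
        apply: preimage_closed; [move=> ? _; exact: cc|exact: closed_ge].
    - by apply: preimage_closed; [move=> v _; exact: continuous_sum|exact: closed_eq].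
    - by apply: preimage_closed; [move=> v _; exact: continuous_prod|exact: closed_le].
  move=> v [v0 vs _] i /=; rewrite in_itv/= v0 -vs (bigD1 i)//= lerDl.
  by apply: sumr_ge0 => j _; exact: v0.
have A0 : A !=set0 by exists (\row_i x i); have := Amx _ Fx; rewrite inE.
have cf : {within A, continuous (fun v : 'rV[R]_T => \sum_i v 0 i ^+ 2)}.
  apply: continuous_subspaceT; apply: continuous_sum => i v.
  exact: (cvgM (cc i v) (cc i v)).
have [v] := EVT_min_rV A0 cA cf; rewrite inE => Av Hv.
exists (v 0) => // z /Amx/Hv /le_trans; apply.
by rewrite le_eqVlt; apply/orP; left; apply/eqP; apply: eq_bigr => i _; rewrite mxE.
Qed.

(** With product below [g], a short move towards the barycenter would stay feasible and strictly
    lower the sum of squares, unless [y] is the barycenter itself; but that point has product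
    [(s / T)^T > g]. *)
Lemma min_sum_sqr_prod (T : nat) (s g : R) (y : 'I_T -> R) :
  prod_le_simplex s g y ->
  (forall z : 'I_T -> R, prod_le_simplex s g z -> \sum_i y i ^+ 2 <= \sum_i z i ^+ 2) ->
  0 <= s -> (0 < T)%N -> g < (s / T%:R) ^+ T -> \prod_i y i = g.
Proof.
move=> [y0 ys yg] ymin s0 T0 gs; apply/eqP; rewrite eq_le yg leNgt; apply/negP => lt_yg.
have T0' : T%:R != 0 :> R by rewrite pnatr_eq0 -lt0n.
pose c := s / T%:R; have c0 : 0 <= c by rewrite divr_ge0.
have sumc : \sum_(i < T) c = s.
  by rewrite sumr_const card_ord -mulr_natl /c; field.
pose z (t : R) i := y i + t * (c - y i).
have zs t : \sum_i z t i = s.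
  by rewrite /z big_split/= -mulr_sumr sumrB sumc ys subrr mulr0 addr0.
(* The product along the segment from [y] to the barycenter is a polynomial in the parameter, hence
   continuous at [0]. *)
pose F : {poly R} := \prod_i ((y i)%:P + (c - y i)%:P * 'X).
have FE t : F.[t] = \prod_i z t i.
  by rewrite horner_prod; apply: eq_bigr => i _; rewrite !hornerE /z mulrC.
have F0 : F.[0] = \prod_i y i.
  by rewrite FE; apply: eq_bigr => i _; rewrite /z mul0r addr0.
have [d d0 Hd] := @poly_cont _ 0 F (g - \prod_i y i) (ltac:(by rewrite subr_gt0)).
pose t := Num.min 1 (d / 2).
have t0 : 0 < t by rewrite lt_min ltr01 divr_gt0.
have t1 : t <= 1 by rewrite ge_min lexx.
have Fz : prod_le_simplex s g (z t).
  split=> //.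
    move=> i; rewrite (_ : z t i = (1 - t) * y i + t * c); last by rewrite /z; ring.
    by rewrite addr_ge0// mulr_ge0 ?subr_ge0// ltW.
  rewrite -FE; have : `|t - 0| < d.
    by rewrite subr0 gtr0_norm// gt_min; apply/orP; right; lra.
  by move=> /Hd; rewrite F0 ltr_norml => /andP[_]; lra.
have := ymin _ Fz.
have -> : \sum_i z t i ^+ 2 =
    (1 - t) ^+ 2 * \sum_i y i ^+ 2 + t * (2 - t) * (s ^+ 2 / T%:R).
  rewrite (eq_bigr (fun i => (1 - t) ^+ 2 * y i ^+ 2 + 2 * (1 - t) * t * c * y i
      + t ^+ 2 * c * c)); last by move=> i _; rewrite /z; ring.
  rewrite !big_split/= sumr_const card_ord -[_ *+ T]mulr_natl -!mulr_sumr ys /c.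
  field.
  by rewrite ?T0'.
set N := \sum_i _ => H.
have E : \sum_i (y i - c) ^+ 2 = N - s ^+ 2 / T%:R.
  rewrite (eq_bigr (fun i => y i ^+ 2 - 2 * c * y i + c * c)); last by move=> i _; ring.
  rewrite !big_split/= sumrN sumr_const card_ord -[_ *+ T]mulr_natl -!mulr_sumr ys.
  rewrite -/N /c; field.
  by rewrite ?T0'.
have : 0 <= \sum_i (y i - c) ^+ 2 by apply: sumr_ge0 => i _; exact: sqr_ge0.
rewrite le_eqVlt => /orP[/eqP e|]; last first.
  rewrite E => h; have : t * (2 - t) * (N - s ^+ 2 / T%:R) <= 0 by nra.
  by rewrite leNgt mulr_gt0// mulr_gt0//; lra.
have yc i : y i = c.
  have := e; move/esym/eqP; rewrite psumr_eq0; last by move=> j _; exact: sqr_ge0.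
  by move=> /allP/(_ i (mem_index_enum _)); rewrite sqrf_eq0 subr_eq0 => /eqP.
have : \prod_i y i = c ^+ T.
  by rewrite (eq_bigr (fun=> c)) ?prodr_const ?card_ord// => i _; exact: yc.
by move=> h; move: gs lt_yg; rewrite h -/c; lra.
Qed.

(** Take a minimizer and let [i0] be the index of a smallest coordinate. If two other coordinates
    differed, [decrease_triple_product] would give another minimizer with product below [g], against
    [min_sum_sqr_prod]. *)
Lemma min_sum_sqr_equal_variables (T : nat) (s g : R) (x : 'I_T -> R) :
  (0 < T)%N -> 0 < g -> g < (s / T%:R) ^+ T -> prod_le_simplex s g x ->
  exists2 y : 'I_T -> R,
    [/\ prod_le_simplex s g y, \prod_i y i = g & \sum_i y i ^+ 2 <= \sum_i x i ^+ 2] &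
    exists i0, forall j k, j != i0 -> k != i0 -> y j = y k.
Proof.
move=> T0 g0 gs Fx; have [y Fy ymin] := min_sum_sqr_attained Fx.
have s0 : 0 <= s by have [x0 <- _] := Fx; apply: sumr_ge0.
have yg := min_sum_sqr_prod Fy ymin s0 T0 gs.
exists y; first by split => //; exact: ymin.
have [y0 ys _] := Fy.
have yp i : 0 < y i.
  rewrite lt_def y0 andbT; apply: contraTneq g0 => yi0.
  by rewrite -yg (bigD1 i)//= yi0 mul0r ltxx.
case: (@arg_minP _ _ _ (Ordinal T0) xpredT y isT) => i0 _ /(_ _ isT) min0.
exists i0.
suff H j k : j != i0 -> k != i0 -> y k <= y j.
  by move=> j k ji ki; apply/eqP; rewrite eq_le !H.
move=> ji ki; rewrite leNgt; apply/negP => yjk.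
have [p' [q' [r' [[p0 q0 r0] e1 e2 e3]]]] :=
  decrease_triple_product (yp i0) (min0 j) yjk.
have kj : k != j by apply: contraTneq yjk => ->; rewrite ltxx.
pose z i := if i == i0 then p' else if i == j then q' else if i == k then r' else y i.
have zi0 : z i0 = p' by rewrite /z eqxx.
have zj : z j = q' by rewrite /z (negbTE ji) eqxx.
have zk : z k = r' by rewrite /z (negbTE ki) (negbTE kj) eqxx.
have zy i : [&& i != i0, i != j & i != k] -> z i = y i.
  by rewrite /z; do 3 case: eqP => //.
have sumE (F : 'I_T -> R) : \sum_i F i = F i0 + F j + F k +
    \sum_(i | [&& i != i0, i != j & i != k]) F i.
  rewrite (bigD1 i0)//= (bigD1 j)//= (bigD1 k)/=; last by rewrite ki.
  by rewrite !addrA; congr (_ + _); apply: eq_bigl => i; rewrite andbA.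
have prodE (F : 'I_T -> R) : \prod_i F i = F i0 * F j * F k *
    \prod_(i | [&& i != i0, i != j & i != k]) F i.
  rewrite (bigD1 i0)//= (bigD1 j)//= (bigD1 k)/=; last by rewrite ki.
  by rewrite !mulrA; congr (_ * _); apply: eq_bigl => i; rewrite andbA.
have zs : \sum_i z i = s.
  by rewrite -ys !sumE zi0 zj zk e1; congr (_ + _); apply: eq_bigr.
have z2 : \sum_i z i ^+ 2 = \sum_i y i ^+ 2.
  rewrite !sumE zi0 zj zk e2; congr (_ + _).
  by apply: eq_bigr => i Hi; rewrite zy.
have zg : \prod_i z i < g.
  rewrite -yg !prodE zi0 zj zk (eq_bigr _ zy) ltr_pM2r//.
  by apply: prodr_gt0.
have Fz : prod_le_simplex s g z.
  split=> //; last exact: ltW.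
  by move=> i; rewrite /z; do 3 case: ifP => // _.
move: zg; rewrite (min_sum_sqr_prod Fz _ s0 T0 gs) ?ltxx// => u /ymin.
by rewrite z2.
Qed.

End EqualVariable.

(** * The dual constraints as univariate inequalities *)

Section DualFeasibility.
Context {R : realType}.

Definition sym_quad (T : nat) (a b g1 g2 : R) (x : 'I_T -> R) : R :=
  a + b * (\sum_i x i) + g1 * (\sum_i x i ^+ 2) + g2 * (\sum_i x i) ^+ 2.

Definition dual_feasible (T : nat) (gamma a b g1 g2 : R) : Prop :=
  forall x : 'I_T -> R, (forall i, 0 <= x i) ->
    0 <= sym_quad a b g1 g2 x /\
    (\prod_i x i <= gamma -> 1 <= sym_quad a b g1 g2 x).

(* [X^2 (sym_quad - 1)] along the curve of product [r ^ (T - 1)] whose [T - 1]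
   equal coordinates are [r / X] and whose last one is [X ^ (T - 1)]. *)
Definition curve_poly (T : nat) (r a b g1 g2 : R) : {poly R} :=
  ((T%:R - 1) * g1 * r ^+ 2 + (T%:R - 1) ^+ 2 * g2 * r ^+ 2)%:P
  + ((T%:R - 1) * b * r) *: 'X + (a - 1) *: 'X^2
  + (2 * (T%:R - 1) * g2 * r) *: ('X ^+ T) + b *: 'X^(T.+1) + (g1 + g2) *: 'X^(2 * T).

Lemma sum_all_but_one (T : nat) (i0 : 'I_T) (F : 'I_T -> R) (v : R) :
  (forall i, i != i0 -> F i = v) -> \sum_i F i = F i0 + (T%:R - 1) * v.
Proof.
move=> H; rewrite (bigD1 i0)//=; congr (_ + _).
rewrite (eq_bigr (fun=> v))// sumr_const cardC1 card_ord -[LHS]mulr_natl.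
by rewrite -subn1 natrB//; apply: leq_trans (ltn_ord i0).
Qed.

Lemma prod_all_but_one (T : nat) (i0 : 'I_T) (F : 'I_T -> R) (v : R) :
  (forall i, i != i0 -> F i = v) -> \prod_i F i = F i0 * v ^+ T.-1.
Proof.
move=> H; rewrite (bigD1 i0)//=; congr (_ * _).
by rewrite (eq_bigr (fun=> v))// prodr_const cardC1 card_ord.
Qed.

Lemma horner_curve_poly (T : nat) (r a b g1 g2 z : R) (i0 : 'I_T)
    (x : 'I_T -> R) :
  z != 0 -> x i0 = z ^+ T.-1 -> (forall i, i != i0 -> x i = r / z) ->
  (curve_poly T r a b g1 g2).[z] = z ^+ 2 * (sym_quad a b g1 g2 x - 1).
Proof.
move=> z0 xi0 xi; rewrite /sym_quad (sum_all_but_one xi).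
rewrite (@sum_all_but_one _ i0 _ ((r / z) ^+ 2)); last first.
  by move=> i ii0; rewrite xi.
rewrite xi0 /curve_poly !hornerE.
case: T i0 x xi0 xi => [[]//|m] i0 x _ _.
(* With [T = m.+1], all powers of [z] are expressed through [z ^+ m], which [field] then treats as
   an atom. *)
rewrite mul2n -addnn addSn addnS !exprS exprD.
move: (z ^+ m) => w /=; field.
exact: z0.
Qed.

Lemma sum_sqr_le_sqr_sum (T : nat) (x : 'I_T -> R) : (forall i, 0 <= x i) ->
  \sum_i x i ^+ 2 <= (\sum_i x i) ^+ 2.
Proof.
move=> x0; rewrite expr2 mulr_suml; apply: ler_sum => i _.
rewrite expr2 ler_wpM2l// (bigD1 i)//= lerDl.
by apply: sumr_ge0.
Qed.

(** Necessity: test at constant vectors, at multiples of a unit vector (product zero), at constant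
    vectors with product at most [gamma], and on the curve. Sufficiency: the quadratic is affine in
    the sum of squares, so for [g1 < 0] its upper end [s^2] decides, and for [g1 >= 0] the lower end
    [s^2 / T] or, when [s > T c], the minimizer with all coordinates but one equal. *)
Lemma dual_feasibleP (T : nat) (gamma r c a b g1 g2 : R) :
  (2 <= T)%N -> 0 < r -> r ^+ T.-1 = gamma -> 0 < c -> c ^+ T = gamma ->
  dual_feasible T gamma a b g1 g2 <->
  [/\ forall s, 0 <= s -> 0 <= a + b * s + (g2 + g1 / T%:R) * s ^+ 2,
      forall s, 0 <= s -> 0 <= (a - 1) + b * s + (g2 + g1) * s ^+ 2,
      forall s, 0 <= s <= T%:R * c ->
        0 <= (a - 1) + b * s + (g2 + g1 / T%:R) * s ^+ 2
    & forall z, 0 < z -> 0 <= (curve_poly T r a b g1 g2).[z]].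
Proof.
move=> T2 r0 rE c0 cE; have T0 : (0 < T)%N by apply: leq_trans T2.
have Tp : 0 < T%:R :> R by rewrite ltr0n.
have Tn0 : T%:R != 0 :> R by rewrite gt_eqF.
have T1 : (0 < T.-1)%N by rewrite -subn1 subn_gt0.
pose i0 := Ordinal T0.
have gamma0 : 0 < gamma by rewrite -rE exprn_gt0.
have quadE (x : 'I_T -> R) : sym_quad a b g1 g2 x = a + b * (\sum_i x i)
    + (g2 + g1 / T%:R) * (\sum_i x i) ^+ 2
    + g1 * (\sum_i x i ^+ 2 - (\sum_i x i) ^+ 2 / T%:R).
  by rewrite /sym_quad; field.
have quadE' (x : 'I_T -> R) : sym_quad a b g1 g2 x = a + b * (\sum_i x i)
    + (g2 + g1) * (\sum_i x i) ^+ 2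
    - g1 * ((\sum_i x i) ^+ 2 - \sum_i x i ^+ 2).
  by rewrite /sym_quad; ring.
split=> [H|[H1 H2 H3 H4]].
- have const (s : R) : 0 <= s -> let x : 'I_T -> R := fun=> s / T%:R in
      [/\ forall i : 'I_T, 0 <= x i, \prod_(i < T) x i = (s / T%:R) ^+ T
        & sym_quad a b g1 g2 x = a + b * s + (g2 + g1 / T%:R) * s ^+ 2].
    move=> s0 x; split; first by move=> i; rewrite divr_ge0.
      by rewrite prodr_const card_ord.
    have constE (k : R) : \sum_(i < T) k = T%:R * k.
      by rewrite sumr_const card_ord mulr_natl.
    by rewrite /sym_quad /x !constE; field.
  split.
  + by move=> s s0; have [x0 _ <-] := const s s0; have [] := H _ x0.
  + move=> s s0; pose x (i : 'I_T) := if i == i0 then s else 0.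
    have x0 i : 0 <= x i by rewrite /x; case: ifP.
    have xi i : i != i0 -> x i = 0 by rewrite /x => /negbTE ->.
    have xi0 : x i0 = s by rewrite /x eqxx.
    have [_] := H x x0; rewrite (prod_all_but_one xi) expr0n gtn_eqF// mulr0.
    rewrite (ltW gamma0) => /(_ isT); rewrite /sym_quad (sum_all_but_one xi).
    rewrite (@sum_all_but_one _ i0 _ 0) => [|i /xi ->]; last by rewrite expr0n.
    by rewrite xi0; lra.
  + move=> s /andP[s0 sK]; have [x0 xg xE] := const s s0.
    have [_] := H _ x0; rewrite xg xE -cE => h {x0}.
    suff /h : (s / T%:R) ^+ T <= c ^+ T by lra.
    by rewrite lerXn2r ?nnegrE ?divr_ge0 ?(ltW c0)// ler_pdivrMr// mulrC.
  + move=> z z0; pose x (i : 'I_T) := if i == i0 then z ^+ T.-1 else r / z.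
    have x0 i : 0 <= x i.
      by rewrite /x; case: ifP => _; [rewrite exprn_ge0// ltW|rewrite divr_ge0// ltW].
    have xi i : i != i0 -> x i = r / z by rewrite /x => /negbTE ->.
    have xi0 : x i0 = z ^+ T.-1 by rewrite /x eqxx.
    rewrite (horner_curve_poly a b g1 g2 (lt0r_neq0 z0) xi0 xi) mulr_ge0 ?sqr_ge0// subr_ge0.
    apply: (proj2 (H x x0)); rewrite (prod_all_but_one xi) xi0 -exprMn mulrC.
    by rewrite divfK ?gt_eqF// rE.
- move=> x x0; set s := \sum_i x i in quadE quadE' *; set n := \sum_i x i ^+ 2.
  have s0 : 0 <= s by apply: sumr_ge0.
  have n1 : s ^+ 2 / T%:R <= n by rewrite ler_pdivrMr// mulrC sum_sqr_ge.
  have n2 : n <= s ^+ 2 by apply: sum_sqr_le_sqr_sum.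
  have [g10|g10] := leP 0 g1; last first.
    have : 1 <= sym_quad a b g1 g2 x.
      rewrite quadE' -/s -/n.
      have : g1 * (s ^+ 2 - n) <= 0 by rewrite nmulr_rle0// subr_ge0.
      by have := H2 s s0; lra.
    by move=> h; split=> //; apply: le_trans h.
  have gn : 0 <= g1 * (n - s ^+ 2 / T%:R) by rewrite mulr_ge0// subr_ge0.
  split; first by rewrite quadE -/s -/n; have := H1 s s0; lra.
  move=> xg; have [sc|sc] := leP s (T%:R * c).
    rewrite quadE -/s -/n; have := H3 s; rewrite s0 sc => /(_ isT); lra.
  have gs : gamma < (s / T%:R) ^+ T.
    rewrite -cE ltrXn2r ?nnegrE ?(ltW c0) ?divr_ge0// -?lt0n//.
    by rewrite ltr_pdivlMr// mulrC.
  have [y [[y0 ys _] yg yn] [i1 yi1]] :=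
    min_sum_sqr_equal_variables T0 gamma0 gs (And3 x0 erefl xg).
  have [i2 i21] : exists i2, i2 != i1.
    by have [->|h] := eqVneq i1 i0; [exists (Ordinal T2)|exists i0; rewrite eq_sym].
  have yi i : i != i1 -> y i = y i2 by move=> ii1; exact: yi1.
  have yp i : 0 < y i.
    rewrite lt_def y0 andbT; apply: contraTneq gamma0 => yi0.
    by rewrite -yg (bigD1 i)//= yi0 mul0r ltxx.
  (* The parameter [z = r / y i2] makes the equal coordinates [r / z]; the product
     [gamma = r ^+ T.-1] then forces the remaining one to be [z ^+ T.-1]. *)
  have z0 : 0 < r / y i2 by rewrite divr_gt0.
  have := H4 _ z0; rewrite (@horner_curve_poly T _ _ _ _ _ _ i1 y) ?gt_eqF//; last first.
  - by move=> i /yi ->; rewrite invf_div mulrCA divff ?mulr1// gt_eqF.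
  - rewrite expr_div_n rE -yg (prod_all_but_one yi) mulfK//.
    by rewrite expf_neq0// gt_eqF.
  rewrite pmulr_rge0 ?exprn_gt0// subr_ge0 => /le_trans; apply.
  rewrite /sym_quad ys -/s lerD2r lerD2l ler_wpM2l//.
Qed.

End DualFeasibility.

(** * Separation of convex sets *)

Section Separation.
Context {R : realType}.

(** Points are infinite sequences, so that an induction can lower the dimension without changing the
    type. *)
Definition convex_coords (S : set (nat -> R)) : Prop :=
  forall u v (t : R), S u -> S v -> 0 <= t <= 1 ->
    exists2 w, S w & forall i, w i = t * u i + (1 - t) * v i.

Lemma convex_coords_crossing S n u v : convex_coords S -> S u -> S v ->
  u n < 0 -> 0 < v n ->
  exists2 w, S w & w n = 0 /\
    exists k : R, 0 < k /\ forall i, w i = k * (v n * u i - u n * v i).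
Proof.
move=> cS Su Sv un vn; have d0 : 0 < v n - u n by rewrite subr_gt0 (lt_trans un).
have [|w Sw Hw] := cS u v (v n / (v n - u n)) Su Sv.
  by rewrite divr_ge0 ?ltW//= ltr_pdivrMr// mul1r ltrBrDl gtrDr.
have dn0 := lt0r_neq0 d0.
exists w => //; split; first by rewrite Hw; field.
exists (v n - u n)^-1; split; first by rewrite invr_gt0.
by move=> i; rewrite Hw; field.
Qed.

(* Induction on the dimension: a functional for the slice [v n = 0] extends to
   the last coordinate, since for [u n < 0 < v n] the segment from [u] to [v]
   meets the slice. *)
Lemma convex_coords_separation n S : convex_coords S ->
  (forall v, S v -> exists2 i, (i < n.+1)%N & v i != 0) ->
  exists2 c : nat -> R, (exists2 i, (i < n.+1)%N & c i != 0) &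
    forall v, S v -> 0 <= \sum_(i < n.+1) c i * v i.
Proof.
have unit_sum k (a : R) (v : nat -> R) :
    \sum_(i < k.+1) (if i == k :> nat then a else 0) * v i = a * v k.
  rewrite big_ord_recr/= eqxx big1 ?add0r// => i _.
  by rewrite ltn_eqF ?mul0r.
elim: n S => [|n IH] S cS S0.
(* Base case and induction step are treated together, [m] being the last coordinate. If it has
   constant sign on [S], plus or minus that coordinate is the functional. *)
all: [> pose m := 0%N | pose m := n.+1].
all: have [posS|/existsNP[u /not_implyP[Su /negP]]] :=
  pselect (forall u, S u -> 0 <= u m);
  first by exists (fun i => if i == m then 1 else 0);
    [exists m; [exact: ltnSn|rewrite eqxx oner_neq0]|move=> v Sv; rewrite (unit_sum m) mul1r;
     exact: posS].
all: rewrite -ltNge => um.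
all: have [negS|/existsNP[v /not_implyP[Sv /negP]]] :=
  pselect (forall v, S v -> v m <= 0);
  first by exists (fun i => if i == m then -1 else 0);
    [exists m; [exact: ltnSn|rewrite eqxx oppr_eq0 oner_neq0]
    |move=> v Sv; rewrite (unit_sum m) mulN1r oppr_ge0; exact: negS].
all: rewrite -ltNge => vm.
  (* In dimension one the crossing point would be zero, which [S0] excludes. *)
  have [w Sw [w0 _]] := convex_coords_crossing cS Su Sv um vm.
  by have [[|//] _] := S0 w Sw; rewrite w0 eqxx.
have [|w [Sw wm]|c [i0 i0n ci0] Hc] := IH (S `&` [set v | v m = 0]).
- move=> x y t [Sx xm] [Sy ym] t01; have [w Sw Hw] := cS x y t Sx Sy t01.
  by exists w => //; split => //=; rewrite Hw xm ym !mulr0 addr0.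
- have [i im wi] := S0 w Sw; exists i => //.
  by move: im; rewrite ltnS leq_eqVlt => /orP[/eqP im|//]; rewrite im wm eqxx in wi.
pose f (v : nat -> R) := \sum_(i < n.+1) c i * v i.
(* Points with [y m > 0] bound the last coefficient from below and points with [x m < 0] bound it
   from above. Nonnegativity of [f] at crossing points makes the bounds compatible, and the supremum
   of the lower ones serves as coefficient. *)
have cross x y : S x -> S y -> x m < 0 -> 0 < y m -> - f y / y m <= f x / - x m.
  move=> Sx Sy xm ym; have [w Sw [wm [k [k0 Hw]]]] := convex_coords_crossing cS Sx Sy xm ym.
  have : 0 <= f w by apply: Hc.
  have -> : f w = k * (y m * f x - x m * f y).
    rewrite /f !mulr_sumr -sumrB mulr_sumr; apply: eq_bigr => i _.
    by rewrite Hw; ring.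
  rewrite pmulr_rge0// => H; rewrite ler_pdivlMr ?oppr_gt0// mulrAC ler_pdivrMr//.
  by lra.
pose A := [set - f y / y m | y in [set y | S y /\ 0 < y m]].
have A0 : A !=set0 by exists (- f v / v m); exists v.
have ubA x : S x -> x m < 0 -> ubound A (f x / - x m).
  by move=> Sx xm _ [y [Sy ym] <-]; exact: cross.
have supA : has_sup A by split => //; exists (f u / - u m); exact: ubA.
exists (fun i => if i == m then sup A else c i).
  by exists i0; [exact: ltnW|rewrite ltn_eqF].
move=> x Sx; rewrite big_ord_recr/= eqxx.
rewrite (eq_bigr (fun i : 'I_n.+1 => c i * x i)); last first.
  by move=> i _; rewrite ltn_eqF.
rewrite -/(f x); have [xm|xm|xm] := ltgtP (x m) 0.
- have : sup A <= f x / - x m by apply: ge_sup => //; exact: ubA.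
  by rewrite ler_pdivlMr ?oppr_gt0//; lra.
- have : - f x / x m <= sup A by apply: ub_le_sup; [exact: (proj2 supA)|exists x].
  by rewrite ler_pdivrMr//; lra.
- by rewrite xm mulr0 addr0; apply: Hc.
Qed.

End Separation.

(** * Finitely supported measures and symmetrization *)

Section AtomicMeasures.
Context {R : realType} d {T : measurableType d}.
Implicit Types (l : seq ({nonneg R} * T)).

Fixpoint atomic_measure l : {measure set T -> \bar R} :=
  if l is a :: l' then measure_add (mscale a.1 (dirac a.2)) (atomic_measure l')
  else mzero.

Lemma atomic_measureE l (A : set T) :
  atomic_measure l A = (\sum_(a <- l) a.1%:num * \1_A a.2)%:E.
Proof.
elim: l => [|a l IH] /=; first by rewrite big_nil.
rewrite big_cons /msum 2!big_ord_recl big_ord0 adde0/= IH /mscale/= diracE.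
by rewrite EFinD EFinM indicE.
Qed.

Lemma ge0_integral_atomic_measure l (f : T -> \bar R) :
  measurable_fun setT f -> (forall x, 0 <= f x)%E ->
  (\int[atomic_measure l]_x f x = \sum_(a <- l) a.1%:num%:E * f a.2)%E.
Proof.
move=> mf f0; elim: l => [|a l IH] /=.
  by rewrite integral_measure_zero big_nil.
apply: (etrans (ge0_integral_measure_add (mscale a.1 \d_(a.2)) (atomic_measure l)
  measurableT _ _)) => //.
rewrite big_cons -IH ge0_integral_mscale//.
by rewrite integral_dirac// diracT mul1e.
Qed.

(** The positive and negative parts have finite integrals, being finite sums, so they can be
    subtracted. *)
Lemma integral_atomic_measure l (f : T -> R) : measurable_fun setT f ->
  (\int[atomic_measure l]_x (f x)%:E = (\sum_(a <- l) a.1%:num * f a.2)%:E)%E.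
Proof.
move=> mf; have mf' : measurable_fun setT (EFin \o f) by exact/measurable_EFinP.
rewrite integralE !ge0_integral_atomic_measure//; last 2 first.
- exact: measurable_funeneg.
- exact: measurable_funepos.
have pE x : (EFin \o f)^\+%E x = (Num.max (f x) 0)%:E.
  by rewrite funeposE EFin_max.
have nE x : (EFin \o f)^\-%E x = (Num.max (- f x) 0)%:E.
  by rewrite funenegE EFin_max.
under eq_bigr do rewrite pE -EFinM.
under [X in (_ - X)%E]eq_bigr do rewrite nE -EFinM.
rewrite !sumEFin -EFinB -sumrB; congr EFin; apply: eq_bigr => a _.
rewrite -mulrBr; congr (_ * _); rewrite /Num.max oppr_lt0.
by case: (ltgtP (f a.2) 0) => [||->]; rewrite ?sub0r ?opprK ?subr0 ?oppr0.
Qed.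

Lemma atomic_probability l : \sum_(a <- l) a.1%:num = 1 ->
  exists P : probability T R, P = atomic_measure l :> (set T -> \bar R).
Proof.
move=> l1; have PT : atomic_measure l setT = 1%E.
  rewrite atomic_measureE; congr EFin; rewrite -[RHS]l1.
  by apply: eq_bigr => a _; rewrite indicT mulr1.
case: l l1 PT => [|a l] l1 PT.
  by move: l1; rewrite big_nil => /esym/eqP; rewrite oner_eq0.
(* Normalization supplies the probability structure and leaves a measure of mass one unchanged; the
   Dirac mass is the default value for degenerate total mass. *)
exists (mnormalize (atomic_measure (a :: l)) (dirac a.2)).
apply/funext => A; rewrite -[LHS]/(mnormalize _ _ A) /mnormalize PT.
by rewrite onee_eq0/= invr1 mule1.
Qed.

End AtomicMeasures.

(** * Averages over the symmetric group *)

Section PermutationAverages.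
Context {R : realFieldType} (T : nat).
Implicit Types (x : 'I_T -> R) (s : {perm 'I_T}).

Lemma card_permT : #|{: {perm 'I_T}}| = T`!.
Proof. by rewrite card_Sn. Qed.

Lemma sum_perm_shift (F : {perm 'I_T} -> R) (t : {perm 'I_T}) :
  \sum_(s : {perm 'I_T}) F s = \sum_(s : {perm 'I_T}) F (t * s)%g.
Proof. by rewrite (reindex_inj (mulgI t)). Qed.

(** Composition with a transposition shows that the sum over permutations does not depend on [i];
    summing over all indices then gives one full coordinate sum per permutation. *)
Lemma sum_perm_coord x i :
  T%:R * \sum_(s : {perm 'I_T}) x (s i) = T`!%:R * \sum_j x j.
Proof.
have H j : \sum_(s : {perm 'I_T}) x (s j) = \sum_(s : {perm 'I_T}) x (s i).
  rewrite (sum_perm_shift _ (tperm i j)); apply: eq_bigr => s _.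
  by rewrite permM tpermR.
transitivity (\sum_(j < T) \sum_(s : {perm 'I_T}) x (s j)).
  by rewrite (eq_bigr _ (fun j _ => H j)) sumr_const card_ord mulr_natl.
rewrite exchange_big/= (eq_bigr (fun=> \sum_j x j)) => [|s _].
  by rewrite sumr_const card_permT mulr_natl.
by rewrite [RHS](reindex_inj (@perm_inj _ s)).
Qed.

Lemma perm_pair_transitive (i j k l : 'I_T) : i != j -> k != l ->
  exists t : {perm 'I_T}, t k = i /\ t l = j.
Proof.
move=> ij kl; exists (tperm k i * tperm (tperm k i l) j)%g.
have li : tperm k i l != i.
  by rewrite -[X in _ != X](tpermL k i) (inj_eq perm_inj) eq_sym.
by rewrite !permM tpermL tpermL (@tpermD _ _ j i)// eq_sym.
Qed.

(** By double transitivity the sum is the same for all [T (T - 1)] ordered pairs of distinct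
    indices, and for each permutation these pairs add up to the square of the sum minus the sum of
    squares. *)
Lemma sum_perm_pair x i j : i != j ->
  T%:R * (T%:R - 1) * \sum_(s : {perm 'I_T}) x (s i) * x (s j) =
  T`!%:R * ((\sum_k x k) ^+ 2 - \sum_k x k ^+ 2).
Proof.
move=> ij; have H k l : l != k ->
    \sum_(s : {perm 'I_T}) x (s k) * x (s l) = \sum_(s : {perm 'I_T}) x (s i) * x (s j).
  rewrite eq_sym => kl; have [t [ti tj]] := perm_pair_transitive kl ij.
  rewrite [RHS](sum_perm_shift _ t); apply: eq_bigr => s _.
  by rewrite !permM ti tj.
have T0 : (0 < T)%N by apply: leq_trans (ltn_ord i).
transitivity (\sum_(k < T) \sum_(l < T | l != k) \sum_(s : {perm 'I_T}) x (s k) * x (s l)).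
  rewrite [RHS](eq_bigr (fun=> (T%:R - 1) * \sum_(s : {perm 'I_T}) x (s i) * x (s j))).
    by rewrite sumr_const card_ord -[RHS]mulr_natl mulrA.
  move=> k _; rewrite (eq_bigr _ (H k)) sumr_const cardC1 card_ord.
  by rewrite -[LHS]mulr_natl -subn1 natrB.
transitivity (\sum_(s : {perm 'I_T}) \sum_k \sum_(l < T | l != k) x (s k) * x (s l)).
  rewrite [RHS]exchange_big; apply: eq_bigr => k _.
  by rewrite [RHS]exchange_big.
rewrite (eq_bigr (fun=> (\sum_k x k) ^+ 2 - \sum_k x k ^+ 2)) => [|s _].
  by rewrite sumr_const card_permT mulr_natl.
have -> : \sum_k x k = \sum_k x (s k) by rewrite (reindex_inj (@perm_inj _ s)).
have -> : \sum_k x k ^+ 2 = \sum_k x (s k) ^+ 2.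
  by rewrite (reindex_inj (@perm_inj _ s)).
rewrite expr2 mulr_suml -sumrB; apply: eq_bigr => k _.
by rewrite mulr_sumr [in RHS](bigD1 k)//= expr2 [RHS]addrC addKr.
Qed.

End PermutationAverages.

Section Symmetrization.
Context {R : realType} (T : nat).
Implicit Types (l : seq ({nonneg R} * outcome R T)).

Definition permute_outcome (s : {perm 'I_T}) (x : outcome R T) : outcome R T :=
  [tuple tnth x (s i) | i < T].

Definition symmetrize l : seq ({nonneg R} * outcome R T) :=
  [seq ((a.1%:num / T`!%:R)%:nng, permute_outcome s a.2) | a <- l, s <- enum {: {perm 'I_T}}].

Lemma sum_symmetrize l (F : outcome R T -> R) :
  \sum_(b <- symmetrize l) b.1%:num * F b.2 =
  \sum_(a <- l) a.1%:num * ((T`!%:R)^-1 * \sum_(s : {perm 'I_T}) F (permute_outcome s a.2)).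
Proof.
rewrite big_allpairs_dep; apply: eq_bigr => a _ /=.
by rewrite big_enum/= mulrA -mulr_sumr.
Qed.

Definition moment l (F : ('I_T -> R) -> R) : R :=
  \sum_(a <- l) a.1%:num * F (tnth a.2).

Definition orthant_atoms l : bool :=
  all (fun a => [forall i, 0 <= (tnth a.2 i : R)]) l.

Lemma eq_moment l (F G : ('I_T -> R) -> R) : orthant_atoms l ->
  (forall x : 'I_T -> R, (forall i, 0 <= x i) -> F x = G x) ->
  moment l F = moment l G.
Proof.
rewrite /moment => + FG; elim: l => [|a l IH]; first by rewrite !big_nil.
by move=> /= /andP[/forallP a0 /IH E]; rewrite !big_cons E (FG (tnth a.2)).
Qed.

Lemma moment_symmetrize l (F G : ('I_T -> R) -> R) : orthant_atoms l ->
  (forall x : 'I_T -> R, (forall i, 0 <= x i) ->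
    \sum_(s : {perm 'I_T}) F (x \o s) = T`!%:R * G x) ->
  moment (symmetrize l) F = moment l G.
Proof.
move=> l0 FG; rewrite /moment (sum_symmetrize _ (fun x => F (tnth x))).
have tE (s : {perm 'I_T}) (x : outcome R T) :
    tnth (permute_outcome s x) = (tnth x : 'I_T -> R) \o s.
  by apply/funext => i; rewrite tnth_mktuple.
rewrite (eq_bigr (fun a : {nonneg R} * outcome R T => a.1%:num *
    ((T`!%:R)^-1 * \sum_(s : {perm 'I_T}) F ((tnth a.2 : 'I_T -> R) \o s)))).
  apply: (@eq_moment l (fun x =>
    (T`!%:R)^-1 * \sum_(s : {perm 'I_T}) F (x \o s)) G l0) => x x0.
  by rewrite FG// mulKf// pnatr_eq0 -lt0n fact_gt0.
by move=> a _; congr (_ * (_ * _)); apply: eq_bigr => s _; rewrite tE.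
Qed.

(* Averaging over the permutations of the coordinates keeps the symmetric
   moments and equalizes all means, all variances and all covariances. *)
Lemma symmetrize_ambiguity_set l (mu sigma rho gamma : R) : (2 <= T)%N ->
  orthant_atoms l -> moment l (fun=> 1) = 1 ->
  moment l (fun x => \sum_i x i) = T%:R * mu ->
  moment l (fun x => \sum_i x i ^+ 2) = T%:R * (mu ^+ 2 + sigma ^+ 2) ->
  moment l (fun x => (\sum_i x i) ^+ 2) =
    T%:R * (T%:R * mu ^+ 2 + sigma ^+ 2 + (T%:R - 1) * rho * sigma ^+ 2) ->
  exists2 P : probability (outcome R T) R, ambiguity_set mu sigma rho P &
    P [set x | \prod_(t < T) tnth x t <= gamma] =
      (moment l (fun x => (\prod_i x i <= gamma)%R%:R))%:E.
Proof.
move=> T2 l0 l1 m1 m2 m3; have T0 : (0 < T)%N by apply: leq_trans T2.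
have Tn0 : T%:R != 0 :> R by rewrite pnatr_eq0 -lt0n.
have T1n0 : T%:R - 1 != 0 :> R.
  by rewrite subr_eq0 -[1]/(1%:R) eqr_nat gtn_eqF.
have Tf0 : T`!%:R != 0 :> R by rewrite pnatr_eq0 -lt0n fact_gt0.
have sumS (F : ('I_T -> R) -> R) :
    (forall x (s : {perm 'I_T}), F (x \o s) = F x) ->
    moment (symmetrize l) F = moment l F.
  move=> FE; apply: moment_symmetrize => // x _.
  by rewrite (eq_bigr (fun=> F x))// sumr_const card_permT mulr_natl.
have [P PE] : exists P : probability (outcome R T) R,
    P = atomic_measure (symmetrize l) :> (set (outcome R T) -> \bar R).
  apply: atomic_probability; transitivity (moment (symmetrize l) (fun=> 1)).
    by apply: eq_bigr => a _; rewrite mulr1.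
  by rewrite sumS.
have EP (F : ('I_T -> R) -> R) :
    measurable_fun setT (fun x : outcome R T => F (tnth x)) ->
    'E_P[fun x => F (tnth x)]%E = (moment (symmetrize l) F)%:E.
  move=> mF; rewrite unlock -(integral_atomic_measure _ mF).
  apply: eq_measure_integral => A _ _; exact: (congr1 (fun m => m A) PE).
have PF (F : ('I_T -> R) -> bool) :
    P [set x | F (tnth x)] = (moment (symmetrize l) (fun x => (F x)%:R))%:E.
  rewrite PE atomic_measureE; congr EFin; apply: eq_bigr => a _.
  by rewrite indicE; congr (_ * (nat_of_bool _)%:R); apply/idP/idP; rewrite in_setE.
have mc i : measurable_fun setT (fun x : outcome R T => (tnth x i : R)).
  exact: measurable_tnth.
exists P.
  split.
  - rewrite (_ : [set x | _] = [set x : outcome R T | [forall i, 0 <= (tnth x i : R)]]); last first.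
      by apply/seteqP; split=> x /= => [?|/forallP//]; apply/forallP.
    rewrite (PF (fun x => [forall i, 0 <= x i])) sumS; last first.
      move=> x s; congr ((nat_of_bool _)%:R); apply/idP/idP => /forallP H; apply/forallP => i.
        by have := H (s^-1%g i); rewrite /= permKV.
      exact: H.
    rewrite -l1; congr EFin; apply: eq_moment => // x x0.
    by rewrite (_ : [forall i, _])//; apply/forallP.
  - move=> i; rewrite (EP (fun x => x i))//.
    rewrite (@moment_symmetrize _ _ (fun x => T%:R^-1 * \sum_i x i))//.
      rewrite /moment; under eq_bigr do rewrite mulrCA.
      rewrite -mulr_sumr -/(moment l (fun x => \sum_i x i)) m1 !mxE mulr1.
      by rewrite mulKf.
    by move=> x _; rewrite mulrCA -(sum_perm_coord x i) mulKf.
  - move=> i j; rewrite (EP (fun x => x i * x j)); last exact: measurable_funM.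
    rewrite !mxE !big_ord1 !mxE !mulr1.
    have [<-|ij] := eqVneq i j.
      rewrite (@moment_symmetrize _ _ (fun x => T%:R^-1 * \sum_i x i ^+ 2))//.
        rewrite /moment; under eq_bigr do rewrite mulrCA.
        rewrite -mulr_sumr -/(moment l (fun x => \sum_i x i ^+ 2)) m2.
        by rewrite mulKf//=; congr EFin; ring.
      by move=> x _; rewrite mulrCA -(sum_perm_coord (fun i => x i ^+ 2) i) mulKf.
    (* Each off-diagonal second moment becomes the difference of the last two prescribed moments
       over [T (T - 1)], which is [mu^2 + rho sigma^2]. *)
    rewrite (@moment_symmetrize _ _ (fun x => (T%:R * (T%:R - 1))^-1 *
        ((\sum_i x i) ^+ 2 - \sum_i x i ^+ 2)))//.
      rewrite /moment; under eq_bigr do rewrite mulrCA [X in _^-1 * X]mulrBr.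
      rewrite -mulr_sumr sumrB -/(moment l (fun x => \sum_i x i ^+ 2)) m2.
      rewrite -/(moment l (fun x => (\sum_i x i) ^+ 2)) m3.
      by congr EFin; rewrite /=; field; rewrite Tn0 T1n0.
    move=> x _; rewrite mulrCA -(sum_perm_pair x ij) mulKf//.
    by rewrite mulf_neq0.
rewrite (PF (fun x => \prod_i x i <= gamma)) sumS// => x s; congr ((nat_of_bool (_ <= _)%R)%:R).
by rewrite [RHS](reindex_inj (@perm_inj _ s)).
Qed.

End Symmetrization.

(** * Weak duality *)

Lemma measurable_prod_le (R : realType) (T : nat) (gamma : R) :
  measurable [set x : outcome R T | \prod_(t < T) tnth x t <= gamma].
Proof.
rewrite (_ : [set x | _] =
    (fun x : outcome R T => \prod_(t < T) tnth x t : R) @^-1` `]-oo, gamma]).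
  rewrite -[X in measurable X]setTI.
  apply: measurable_prod => // i _; exact: (@measurable_tnth _ (measurableTypeR R)).
by apply/seteqP; split=> x /=; rewrite in_itv.
Qed.

Section WeakDuality.
Context {R : realType} (T : nat) (P : probability (outcome R T) R).
Implicit Types (f g : outcome R T -> R).

(** Integrability is carried along with the value, so that linearity of the integral applies at
    every step. *)
Definition has_mean f (m : R) : Prop :=
  P.-integrable setT (EFin \o f) /\ (\int[P]_x (f x)%:E = m%:E)%E.

Lemma has_mean_cst (c : R) : has_mean (cst c) c.
Proof.
split; last by rewrite /= integral_cst// [X in (_ * X)%E]probability_setT mule1.
exact: finite_measure_integrable_cst.
Qed.

Lemma has_meanD f g m n :
  has_mean f m -> has_mean g n -> has_mean (fun x => f x + g x) (m + n).
Proof.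
move=> [If Ef] [Ig Eg]; split.
  by have := integrableD measurableT If Ig; apply: eq_integrable.
by rewrite EFinD -Ef -Eg -integralD_EFin.
Qed.

Lemma has_meanZ (c : R) f m : has_mean f m -> has_mean (fun x => c * f x) (c * m).
Proof.
move=> [If Ef]; split.
  by have := integrableZl measurableT c If; apply: eq_integrable.
by rewrite EFinM -Ef -integralZl.
Qed.

Lemma has_mean_sum (I : Type) (r : seq I) (f : I -> outcome R T -> R) (m : I -> R) :
  (forall i, has_mean (f i) (m i)) ->
  has_mean (fun x => \sum_(i <- r) f i x) (\sum_(i <- r) m i).
Proof.
move=> fm; elim: r => [|i r IH].
  rewrite big_nil (_ : (fun _ => _) = cst 0); first exact: has_mean_cst.
  by apply/funext => x; rewrite big_nil.
rewrite big_cons (_ : (fun _ => _) = fun x => f i x + \sum_(j <- r) f j x).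
  exact: has_meanD.
by apply/funext => x; rewrite big_cons.
Qed.

Lemma expectation_has_mean f m :
  P.-integrable setT (EFin \o f) -> 'E_P[f]%E = m%:E -> has_mean f m.
Proof. by move=> If; rewrite unlock => Ef; split. Qed.

Lemma ler_normM_Dsqr (y z : R) : `|y * z| <= y * y + z * z.
Proof.
have := sqr_ge0 (`|y| - `|z|); have := mulr_ge0 (normr_ge0 y) (normr_ge0 z).
by rewrite normrM -!expr2 -[y ^+ 2]real_normK ?num_real// -[z ^+ 2]real_normK ?num_real//; nra.
Qed.

Lemma ler_norm_1Dsqr (y : R) : `|y| <= 1 + y * y.
Proof. by have := ler_normM_Dsqr 1 y; rewrite mul1r mulr1. Qed.

Variables (mu sigma rho : R) (P_amb : ambiguity_set mu sigma rho P).

Let coord_measurable i : measurable_fun setT (fun x : outcome R T => (tnth x i : R)).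
Proof. exact: measurable_tnth. Qed.

Let sqr_integrable i :
  P.-integrable setT (EFin \o (fun x : outcome R T => (tnth x i * tnth x i : R))).
Proof.
have [_ _ /(_ i i)] := P_amb; rewrite unlock => E2.
apply/integrableP; split; first by apply/measurable_EFinP; exact: measurable_funM.
under eq_integral => x _ do rewrite /= ger0_norm -?expr2 ?sqr_ge0// expr2.
by rewrite E2 ltry.
Qed.

(** The value of the expectation does not by itself give integrability; that comes from domination
    by [1 + x_i^2], whose integral is finite by the second moment condition. *)
Lemma ambiguity_set_mean1 i : has_mean (fun x => tnth x i) mu.
Proof.
have [_ /(_ i) E1 _] := P_amb.
apply: expectation_has_mean; last by rewrite E1 !mxE mulr1.
have [I1 _] := has_mean_cst 1.
apply: (le_integrable measurableT _ _ (integrableD measurableT I1 (sqr_integrable i))).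
  exact/measurable_EFinP.
move=> x _ /=; rewrite lee_fin [leRHS]ger0_norm; last first.
  by rewrite addr_ge0// -expr2 sqr_ge0.
exact: ler_norm_1Dsqr.
Qed.

Lemma ambiguity_set_mean2 i j : has_mean (fun x => tnth x i * tnth x j)
  ((i == j)%:R * ((1 - rho) * sigma ^+ 2) + rho * sigma ^+ 2 + mu ^+ 2).
Proof.
have [_ _ /(_ i j) E2] := P_amb.
apply: expectation_has_mean; last first.
  by rewrite E2 !mxE !big_ord1 !mxE !mulr1; congr EFin; ring.
apply: (le_integrable measurableT _ _
  (integrableD measurableT (sqr_integrable i) (sqr_integrable j))).
  by apply/measurable_EFinP; exact: measurable_funM.
move=> x _ /=; rewrite lee_fin [leRHS]ger0_norm; last first.
  by rewrite addr_ge0// -expr2 sqr_ge0.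
exact: ler_normM_Dsqr.
Qed.

Definition dual_objective (a b g1 g2 : R) : R :=
  a + T%:R * mu * b + T%:R * (mu ^+ 2 + sigma ^+ 2) * g1
  + T%:R * (T%:R * mu ^+ 2 + sigma ^+ 2 + (T%:R - 1) * rho * sigma ^+ 2) * g2.

Lemma ambiguity_set_mean_sym_quad (a b g1 g2 : R) :
  has_mean (fun x => sym_quad a b g1 g2 (tnth x)) (dual_objective a b g1 g2).
Proof.
have := has_meanD (has_meanD (has_meanD (has_mean_cst a)
  (has_meanZ b (has_mean_sum (index_enum 'I_T) ambiguity_set_mean1)))
  (has_meanZ g1 (has_mean_sum (index_enum 'I_T) (fun i => ambiguity_set_mean2 i i))))
  (has_meanZ g2 (has_mean_sum (index_enum 'I_T) (fun i =>
     has_mean_sum (index_enum 'I_T) (ambiguity_set_mean2 i)))).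
congr has_mean.
  apply/funext => x; rewrite /sym_quad; congr (_ + _ * _).
  by rewrite expr2 mulr_suml; apply: eq_bigr => i _; rewrite mulr_sumr.
have E (i : 'I_T) : \sum_(j < T)
    ((i == j)%:R * ((1 - rho) * sigma ^+ 2) + rho * sigma ^+ 2 + mu ^+ 2) =
    (1 - rho) * sigma ^+ 2 + T%:R * (rho * sigma ^+ 2 + mu ^+ 2).
  under eq_bigr do rewrite -addrA.
  rewrite big_split/= sumr_const card_ord mulr_natl; congr (_ + _).
  rewrite (bigD1 i)//= eqxx mul1r big1 ?addr0// => j ji.
  by rewrite eq_sym (negbTE ji) mul0r.
have constE (k : R) : \sum_(i < T) k = T%:R * k.
  by rewrite sumr_const card_ord mulr_natl.
rewrite (eq_bigr _ (fun i _ => E i)) constE constE.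
rewrite (eq_bigr (fun=> sigma ^+ 2 + mu ^+ 2)) => [|i _]; last by rewrite eqxx /=; ring.
by rewrite constE /dual_objective; ring.
Qed.

(** On the orthant the quadratic dominates the indicator of the event. The complement of the orthant
    has probability zero, so both integrals may be restricted to the orthant and compared there. *)
Lemma weak_duality (gamma a b g1 g2 : R) : dual_feasible T gamma a b g1 g2 ->
  (P [set x : outcome R T | (\prod_(t < T) tnth x t <= gamma)%R] <=
   (dual_objective a b g1 g2)%:E)%E.
Proof.
move=> df; set A := [set x | _].
have mA : measurable A := measurable_prod_le gamma.
have [PO _ _] := P_amb; set O := [set x | _] in PO.
have mO : measurable O.
  rewrite (_ : O = \bigcap_(i in [set: 'I_T])
      ((fun x : outcome R T => tnth x i : R) @^-1` `[0, +oo[)).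
    apply: fin_bigcap_measurable => // i _.
    rewrite -[X in measurable X]setTI.
    exact: (@coord_measurable i measurableT _ (measurable_itv _)).
  apply/seteqP; split=> x /= H i; first by move=> _; rewrite /= in_itv/= H.
  by have := H i Logic.I; rewrite /= in_itv/= andbT.
have PN : P (~` O) = 0%E by rewrite [LHS]probability_setC// PO subee.
have [Ih Eh] := ambiguity_set_mean_sym_quad a b g1 g2.
rewrite -Eh (negligible_integral (measurableC mO) measurableT Ih PN).
rewrite setTD setCK -[A in P A]setIT -(integral_indic P measurableT mA).
rewrite (negligible_integral (measurableC mO) measurableT _ PN); last first.
  exact: integrable_indic.
rewrite setTD setCK; apply: ge0_le_integral => //.
- exact/measurable_EFinP.
- by apply: measurable_funTS; have /measurable_int := Ih.
move=> x /= Ox; rewrite lee_fin indicE; have [h0 h1] := df (tnth x) Ox.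
by have [|_] := boolP (x \in A); [rewrite in_setE => /h1|].
Qed.

End WeakDuality.

(** * Strong duality *)

Section StrongDuality.
Context {R : realType} (T : nat).
Implicit Types (l : seq ({nonneg R} * outcome R T)) (F : ('I_T -> R) -> R).

Definition scale_atoms (t : {nonneg R}) l : seq ({nonneg R} * outcome R T) :=
  [seq ((t%:num * a.1%:num)%:nng, a.2) | a <- l].

Lemma moment_scale_atoms t l F : moment (scale_atoms t l) F = t%:num * moment l F.
Proof.
rewrite /moment big_map mulr_sumr; apply: eq_bigr => a _ /=.
by rewrite mulrA.
Qed.

Lemma moment_cat l l' F : moment (l ++ l') F = moment l F + moment l' F.
Proof. by rewrite /moment big_cat. Qed.

Lemma orthant_atoms_scale t l : orthant_atoms (scale_atoms t l) = orthant_atoms l.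
Proof. by rewrite /orthant_atoms all_map. Qed.

Definition atom (x : 'I_T -> R) : outcome R T := [tuple x i | i < T].

Lemma tnth_atom x : tnth (atom x) = x :> ('I_T -> R).
Proof. by apply/funext => i; rewrite tnth_mktuple. Qed.

(** Serves both for the interior moment point and, with weights [1, 0, 0], for a single Dirac
    mass. *)
Lemma three_atoms (w0 w1 w2 : R) (x0 x1 x2 : 'I_T -> R) :
  0 <= w0 -> 0 <= w1 -> 0 <= w2 ->
  (forall i, 0 <= x0 i) -> (forall i, 0 <= x1 i) -> (forall i, 0 <= x2 i) ->
  exists2 l, orthant_atoms l &
    forall F, moment l F = w0 * F x0 + w1 * F x1 + w2 * F x2.
Proof.
move=> w00 w10 w20 x00 x10 x20.
exists [:: (NngNum w00, atom x0); (NngNum w10, atom x1); (NngNum w20, atom x2)].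
  rewrite /orthant_atoms /= andbT; apply/and3P.
  by split; apply/forallP => i; rewrite tnth_mktuple.
by move=> F; rewrite /moment !big_cons big_nil /= !tnth_atom addr0 addrA.
Qed.

(** The function is [k s (s - S)], which changes sign at [S] unless [k = 0]; the points [S / 2] and
    [2 S] detect this. *)
Lemma halfline_tangent_eq0 (b k S : R) : 0 < S ->
  (forall s, 0 <= s -> 0 <= b * s + k * s ^+ 2) -> b * S + k * S ^+ 2 = 0 ->
  b = 0 /\ k = 0.
Proof.
move=> S0 H HS; have bE : b = - k * S.
  by apply: (mulIf (lt0r_neq0 S0)); apply/eqP; rewrite -subr_eq0 -HS; apply/eqP; ring.
have := H (S / 2) (ltW (divr_gt0 S0 (ltr0n _ 2))).
have := H (2 * S) (ltW (mulr_gt0 (ltr0n _ 2) S0)).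
rewrite bE => h1 h2.
have S20 : 0 < S ^+ 2 by rewrite exprn_gt0.
have k1 : 0 <= k * S ^+ 2 by move: h1; rewrite !expr2; nra.
have k2 : k * S ^+ 2 <= 0.
  have -> : k * S ^+ 2 = -4 * (- k * S * (S / 2) + k * (S / 2) ^+ 2) by field.
  by rewrite mulNr oppr_le0 mulr_ge0.
have /eqP : k * S ^+ 2 = 0 by apply/eqP; rewrite eq_le k1 k2.
by rewrite mulf_eq0 (gt_eqF S20) orbF => /eqP k0; rewrite k0 oppr0 mul0r.
Qed.

(** Only permutation-invariant moments are prescribed; symmetrization turns such a measure into a
    member of the ambiguity set. *)
Definition feasible_atoms (M1 M2 M3 : R) l : Prop :=
  [/\ [/\ orthant_atoms l & moment l (fun=> 1) = 1],
      moment l (fun x => \sum_i x i) = M1,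
      moment l (fun x => \sum_i x i ^+ 2) = M2
    & moment l (fun x => (\sum_i x i) ^+ 2) = M3].

Section Moments.
Variables (M1 M2 M3 : R).
Hypotheses (T2 : (2 <= T)%N) (M10 : 0 < M1) (M13 : M1 ^+ 2 < M3)
  (M32 : M3 < T%:R * M2) (M23 : M2 < M3).

(* The moments are matched by a positive mixture of [0], of a vertex and of
   the barycenter of one simplex; a quadratic that is nonnegative on the
   orthant and has mean zero vanishes at these three points, hence identically:
   the moment vector is an interior point. *)
Lemma feasible_atoms_interior :
  (exists l, feasible_atoms M1 M2 M3 l) /\
  forall a b g1 g2,
    (forall x : 'I_T -> R, (forall i, 0 <= x i) -> 0 <= sym_quad a b g1 g2 x) ->
    a + M1 * b + M2 * g1 + M3 * g2 = 0 -> [/\ a = 0, b = 0, g1 = 0 & g2 = 0].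
Proof.
have T0 : (0 < T)%N by apply: leq_trans T2.
have Tn0 : T%:R != 0 :> R by rewrite pnatr_eq0 -lt0n.
have Tp : 0 < T%:R :> R by rewrite ltr0n.
have T1p : 0 < T%:R - 1 :> R by rewrite subr_gt0 ltr1n.
have T1n0 : T%:R - 1 != 0 :> R by rewrite gt_eqF.
have M30 : 0 < M3 by rewrite (le_lt_trans _ M13)// sqr_ge0.
have M1n0 : M1 != 0 by rewrite gt_eqF.
have M3n0 : M3 != 0 by rewrite gt_eqF.
(* The two nonzero atoms have coordinate sum [S] and total weight [p], so that [p S = M1] and
   [p S^2 = M3]. The fraction [th] of this weight at the barycenter is solved from the prescribed
   [M2]. *)
pose S := M3 / M1; have S0 : 0 < S by rewrite divr_gt0.
pose p := M1 ^+ 2 / M3; pose th := T%:R * (M3 - M2) / ((T%:R - 1) * M3).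
have w0 : 0 < 1 - p by rewrite subr_gt0 ltr_pdivrMr// mul1r.
have p0 : 0 < p by rewrite divr_gt0 ?exprn_gt0.
have th0 : 0 < th by rewrite divr_gt0 ?mulr_gt0// subr_gt0.
have th1 : 0 < 1 - th.
  rewrite (_ : 1 - th = (T%:R * M2 - M3) / ((T%:R - 1) * M3)).
    by rewrite divr_gt0 ?mulr_gt0// subr_gt0.
  by rewrite /th; field; rewrite M3n0 T1n0.
have w1 : 0 < p * (1 - th) by rewrite mulr_gt0.
have w2 : 0 < p * th by rewrite mulr_gt0.
pose i0 := Ordinal T0.
pose vert (s : R) (i : 'I_T) := if i == i0 then s else 0.
pose bary (s : R) (i : 'I_T) := s / T%:R.
have vert0 s : 0 <= s -> forall i, 0 <= vert s i.
  by move=> s0 i; rewrite /vert; case: ifP.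
have bary0 s : 0 <= s -> forall i, 0 <= bary s i.
  by move=> s0 i; rewrite divr_ge0.
have vi s i : i != i0 -> vert s i = 0 by rewrite /vert => /negbTE ->.
have vi2 s i : i != i0 -> vert s i ^+ 2 = 0 by move=> /vi ->; rewrite expr0n.
have vi0 s : vert s i0 = s by rewrite /vert eqxx.
have sv s : \sum_i vert s i = s by rewrite (sum_all_but_one (vi s)) vi0 mulr0 addr0.
have nv s : \sum_i vert s i ^+ 2 = s ^+ 2.
  by rewrite (sum_all_but_one (vi2 s)) vi0 mulr0 addr0.
have sb s : \sum_i bary s i = s.
  by rewrite /bary sumr_const card_ord -[LHS]mulr_natl; field.
have nb s : \sum_i bary s i ^+ 2 = s ^+ 2 / T%:R.
  by rewrite /bary sumr_const card_ord -[LHS]mulr_natl; field.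
split.
  have [l l0 lF] := three_atoms (ltW w0) (ltW w1) (ltW w2) (vert0 0 (lexx _))
    (vert0 S (ltW S0)) (bary0 S (ltW S0)).
  exists l; split; first split => //; rewrite lF ?sv ?nv ?sb ?nb /p /S.
  - ring.
  - by field; rewrite M1n0.
  - by rewrite /th; field; rewrite M1n0 M3n0 T1n0 Tn0.
  - by field; rewrite M1n0 M3n0.
move=> a b g1 g2 q0 E.
have qv s : sym_quad a b g1 g2 (vert s) = a + (b * s + (g2 + g1) * s ^+ 2).
  by rewrite /sym_quad sv nv; ring.
have qb s : sym_quad a b g1 g2 (bary s) = a + (b * s + (g2 + g1 / T%:R) * s ^+ 2).
  by rewrite /sym_quad sb nb; field.
have E' : (1 - p) * sym_quad a b g1 g2 (vert 0) +
    p * (1 - th) * sym_quad a b g1 g2 (vert S) +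
    p * th * sym_quad a b g1 g2 (bary S) = 0.
  rewrite !qv qb -[RHS]E /th /p /S; field.
  by rewrite Tn0 M1n0 M3n0 T1n0.
have e0 : 0 <= sym_quad a b g1 g2 (vert 0) by apply/q0/vert0.
have e1 : 0 <= sym_quad a b g1 g2 (vert S) by apply/q0/vert0/ltW.
have e2 : 0 <= sym_quad a b g1 g2 (bary S) by apply/q0/bary0/ltW.
have eq0 (w e r : R) : 0 < w -> 0 <= e -> 0 <= r -> w * e + r = 0 -> e = 0.
  move=> wp ep rp; move/eqP; rewrite paddr_eq0 ?mulr_ge0// ?(ltW wp)//.
  by rewrite mulf_eq0 (gt_eqF wp)/= => /andP[/eqP].
have z0 : sym_quad a b g1 g2 (vert 0) = 0.
  apply: (eq0 _ _ _ w0 e0 _); last by rewrite -[RHS]E' -addrA; reflexivity.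
  by rewrite addr_ge0// mulr_ge0// ltW.
have z1 : sym_quad a b g1 g2 (vert S) = 0.
  apply: (eq0 _ _ (p * th * sym_quad a b g1 g2 (bary S)) w1 e1 _).
    by rewrite mulr_ge0// ltW.
  by rewrite -[RHS]E' z0 mulr0 add0r.
have z2 : sym_quad a b g1 g2 (bary S) = 0.
  by apply: (eq0 _ _ 0 w2 e2 _) => //; rewrite -[RHS]E' z0 z1 !mulr0 !add0r addr0.
have a0 : a = 0 by move: z0; rewrite qv mulr0 expr2 !mulr0 !addr0.
have [b0 k0] : b = 0 /\ g2 + g1 = 0.
  apply: (halfline_tangent_eq0 S0); last by move: z1; rewrite qv a0 add0r.
  by move=> s s0; have := q0 _ (vert0 s s0); rewrite qv a0 add0r.
have [_ k1] : b = 0 /\ g2 + g1 / T%:R = 0.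
  apply: (halfline_tangent_eq0 S0); last by move: z2; rewrite qb a0 add0r.
  by move=> s s0; have := q0 _ (bary0 s s0); rewrite qb a0 add0r.
have g10 : g1 = 0.
  apply: (mulfI T1n0); rewrite mulr0.
  transitivity (T%:R * ((g2 + g1) - (g2 + g1 / T%:R))); first by field.
  by rewrite k0 k1 subrr mulr0.
by split=> //; move: k0; rewrite g10 addr0.
Qed.

(** The deviations of moments and probability from [(M1, M2, M3, L)] form a convex set that misses
    the origin. In a separating functional [c] the weight [c 3] of the probability is negative, and
    division by [- c 3] yields dual variables of objective exactly [L]. *)
Lemma strong_duality (gamma L : R) :
  (forall l, feasible_atoms M1 M2 M3 l ->
     moment l (fun x => (\prod_i x i <= gamma)%R%:R) < L) ->
  exists a b g1 g2, dual_feasible T gamma a b g1 g2 /\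
    a + M1 * b + M2 * g1 + M3 * g2 = L.
Proof.
move=> HL; have [[l1 Fl1] interior] := feasible_atoms_interior.
pose f (x : 'I_T -> R) : R := (\prod_i x i <= gamma)%R%:R.
pose dev l (i : nat) : R := match i with
  | 0%N => moment l (fun x => \sum_i x i) - M1
  | 1%N => moment l (fun x => \sum_i x i ^+ 2) - M2
  | 2%N => moment l (fun x => (\sum_i x i) ^+ 2) - M3
  | _ => moment l f - L end.
pose S := [set dev l | l in [set l | orthant_atoms l /\ moment l (fun=> 1) = 1]].
have cS : convex_coords S.
  move=> _ _ t [l [l0 lm] <-] [l' [l'0 l'm] <-] /andP[t0 t1].
  have t1' : 0 <= 1 - t by rewrite subr_ge0.
  pose l'' := scale_atoms (NngNum t0) l ++ scale_atoms (NngNum t1') l'.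
  have mE F : moment l'' F = t * moment l F + (1 - t) * moment l' F.
    by rewrite moment_cat !moment_scale_atoms.
  exists (dev l''); last by case=> [|[|[|i]]] /=; rewrite mE; ring.
  exists l'' => //; split; last by rewrite mE lm l'm; ring.
  by rewrite /orthant_atoms all_cat -!/(orthant_atoms _) !orthant_atoms_scale l0.
have S0 v : S v -> exists2 i, (i < 4)%N & v i != 0.
  move=> [l [l0 lm] <-].
  have [e0|?] := eqVneq (dev l 0%N) 0; last by exists 0%N.
  have [e1|?] := eqVneq (dev l 1%N) 0; last by exists 1%N.
  have [e2|?] := eqVneq (dev l 2%N) 0; last by exists 2%N.
  exists 3%N => //; rewrite lt_eqF// subr_lt0; apply: HL.
  by split=> //; apply/eqP; rewrite -subr_eq0; apply/eqP.
have [c [i0 i04 ci0] Hc] := convex_coords_separation cS S0.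
have {}Hc l : orthant_atoms l -> moment l (fun=> 1) = 1 ->
    0 <= c 0%N * dev l 0%N + c 1%N * dev l 1%N + c 2%N * dev l 2%N + c 3%N * dev l 3%N.
  move=> l0 lm; have := Hc (dev l) (ex_intro2 _ _ l (conj l0 lm) erefl).
  by rewrite !big_ord_recr big_ord0 /= add0r.
pose K := c 0%N * M1 + c 1%N * M2 + c 2%N * M3 + c 3%N * L.
(* Dirac masses turn the inequality between moments into a pointwise one. *)
have Hx x : (forall i, 0 <= x i) ->
    0 <= sym_quad (- K) (c 0%N) (c 1%N) (c 2%N) x + c 3%N * f x.
  move=> x0; have [l l0 lF] := three_atoms ler01 (lexx 0) (lexx 0) x0 x0 x0.
  have := Hc l l0; rewrite /dev !lF !mul0r !addr0 !mul1r => /(_ erefl).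
  by rewrite /sym_quad /K; congr (_ <= _); ring.
(* At a feasible measure the moment deviations vanish and the last deviation is negative, which
   fixes the sign. *)
have c30 : c 3%N <= 0.
  have [[l10 l1m] e0 e1 e2] := Fl1; have := Hc l1 l10 l1m.
  rewrite /= e0 e1 e2 !subrr !mulr0 !add0r; have := HL _ Fl1; rewrite -/f -subr_lt0.
  by move=> h; rewrite nmulr_lge0.
(* If the probability had weight zero, the quadratic would be nonnegative on the orthant with mean
   zero, and interiority would annihilate the whole functional. *)
have [c300|c3n0] := eqVneq (c 3%N) 0.
  have [||K0 c00 c10 c20] := interior (- K) (c 0%N) (c 1%N) (c 2%N).
  - by move=> x /Hx; rewrite c300 mul0r addr0.
  - by rewrite /K c300; ring.
  by case: i0 i04 ci0 => [|[|[|[|//]]]] _; rewrite ?c00 ?c10 ?c20 ?c300 eqxx.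
have w0 : 0 < - c 3%N by rewrite oppr_gt0 lt_def eq_sym c3n0.
exists (- K / - c 3%N), (c 0%N / - c 3%N), (c 1%N / - c 3%N), (c 2%N / - c 3%N); split.
  move=> x x0; have fq : f x <= sym_quad (- K / - c 3%N) (c 0%N / - c 3%N)
      (c 1%N / - c 3%N) (c 2%N / - c 3%N) x.
    have -> : sym_quad (- K / - c 3%N) (c 0%N / - c 3%N) (c 1%N / - c 3%N)
        (c 2%N / - c 3%N) x = sym_quad (- K) (c 0%N) (c 1%N) (c 2%N) x / - c 3%N.
      by rewrite /sym_quad; field.
    by rewrite ler_pdivlMr//; have := Hx x x0; lra.
  split; first by apply: le_trans fq; rewrite ler0n.
  by move=> xg; apply: le_trans fq; rewrite /f xg.
by rewrite /K; field.
Qed.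

End Moments.

End StrongDuality.

(** * The semidefinite program *)

Section Gram.
Context {R : realType}.

(** The polynomial with the antidiagonal sums as coefficients is the quadratic form of [A] at the
    vector of powers of [z]; [N] must exceed every index sum. *)
Lemma sum_antidiag_horner (n N : nat) (A : 'M[R]_n) (z : R) :
  (forall i j : 'I_n, (i + j < N)%N) ->
  \sum_(t < N) antidiag_sum A t * z ^+ t =
  ((\col_i z ^+ i : 'cV[R]_n)^T *m A *m (\col_i z ^+ i : 'cV[R]_n)) 0 0.
Proof.
move=> HN; rewrite /antidiag_sum; under eq_bigr do rewrite mulr_suml.
rewrite exchange_big mxE /=.
have -> : \sum_j ((\col_i z ^+ i : 'cV[R]_n)^T *m A) 0 j * (\col_i z ^+ i : 'cV[R]_n) j 0 =
    \sum_(j < n) \sum_(i < n) A i j * z ^+ (i + j).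
  apply: eq_bigr => j _; rewrite !mxE mulr_suml; apply: eq_bigr => i _.
  by rewrite !mxE exprD mulrAC [_ * A i j]mulrC mulrA.
rewrite [RHS]exchange_big /=; apply: eq_bigr => i _.
under eq_bigr do rewrite big_mkcond mulr_suml.
rewrite exchange_big /=; apply: eq_bigr => j _.
rewrite (bigD1 (Ordinal (HN i j)))//= eqxx big1 ?addr0// => t ti.
by rewrite -val_eqE/= eq_sym in ti; rewrite (negbTE ti) mul0r.
Qed.

Lemma psd_antidiag_horner (n N : nat) (A : 'M[R]_n) (z : R) :
  (forall i j : 'I_n, (i + j < N)%N) -> psd A ->
  0 <= \sum_(t < N) antidiag_sum A t * z ^+ t.
Proof. by move=> HN [_ A0]; rewrite sum_antidiag_horner. Qed.

Definition gram_mx (n : nat) (s : seq {poly R}) : 'M[R]_n :=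
  \matrix_(i, j) \sum_(a <- s) a`_i * a`_j.

Lemma psd_gram_mx n s : psd (gram_mx n s).
Proof.
split; first by apply/matrixP => i j; rewrite !mxE; apply: eq_bigr => a _; rewrite mulrC.
move=> x; rewrite mxE.
have -> : \sum_j (x^T *m gram_mx n s) 0 j * x j 0 =
    \sum_(a <- s) (\sum_(i < n) a`_i * x i 0) ^+ 2.
  rewrite (eq_bigr (fun j : 'I_n => \sum_(a <- s) (\sum_(i < n) a`_i * x i 0) * (a`_j * x j 0))).
    rewrite exchange_big; apply: eq_bigr => a _.
    by rewrite -mulr_sumr expr2.
  move=> j _; rewrite mxE mulr_suml.
  rewrite (eq_bigr (fun i : 'I_n => \sum_(a <- s) (a`_i * x i 0) * (a`_j * x j 0))).
    by rewrite exchange_big; apply: eq_bigr => a _; rewrite mulr_suml.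
  move=> i _; rewrite !mxE mulr_sumr mulr_suml; apply: eq_bigr => a _.
  by ring.
by apply: sumr_ge0 => a _; exact: sqr_ge0.
Qed.

Lemma antidiag_sum_gram_mx n (s : seq {poly R}) t : (forall a, a \in s -> (size a <= n)%N) ->
  antidiag_sum (gram_mx n s) t = (\sum_(a <- s) a ^+ 2)`_t.
Proof.
move=> sn; rewrite coef_sum /antidiag_sum.
transitivity (\sum_(a <- s) \sum_(i < n) \sum_(j < n | (i + j == t)%N) a`_i * a`_j).
  rewrite exchange_big; apply: eq_bigr => i _ /=.
  rewrite exchange_big; apply: eq_bigr => j _ /=.
  by rewrite mxE.
rewrite !big_seq; apply: eq_bigr => a /sn an.
have aE : a = \sum_(i < n) a`_i *: 'X^i.
  rewrite -(poly_def n (fun i => a`_i)); apply/polyP => i; rewrite coef_poly.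
  by case: ltnP => // ni; rewrite nth_default// (leq_trans an).
rewrite [in RHS]aE expr2 mulr_suml coef_sum; apply: eq_bigr => i _.
rewrite mulr_sumr coef_sum big_mkcond/=; apply: eq_bigr => j _.
rewrite -scalerAl -scalerAr -exprD !coefZ coefXn eq_sym.
by case: eqP => _; rewrite ?mulr1// !mulr0.
Qed.

Lemma antidiag_sum_overflow n (A : 'M[R]_n) t : (2 * n <= t.+1)%N ->
  antidiag_sum A t = 0.
Proof.
move=> nt; rewrite /antidiag_sum big1// => i _; rewrite big1// => j /eqP ij.
by have := ltn_ord i; have := ltn_ord j; lia.
Qed.

(** Turns the coefficients [q_(t-1)], absent at both ends, into the polynomial [z q(z)]. *)
Lemma sum_shift_interior (N m : nat) (f : nat -> R) (z : R) : N = m.+2 ->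
  \sum_(t < N.+1) (if (0 < t < N)%N then f (t - 1)%N else 0) * z ^+ t =
  z * \sum_(t < m.+1) f t * z ^+ t.
Proof.
move=> ->; rewrite big_ord_recl big_ord_recr/= mul0r add0r.
rewrite /bump/= add1n ltnn mul0r addr0 mulr_sumr; apply: eq_bigr => t _.
rewrite /bump/= !add1n; have -> : (t.+1 < m.+2)%N by have := ltn_ord t; lia.
by rewrite subn1/= exprS; ring.
Qed.

End Gram.

(** * Program constraints as dual constraints *)

Section SdpDual.
Context {R : realType} (T : nat) (gamma : R).
Hypotheses (T2 : (2 <= T)%N) (gamma0 : 0 < gamma).
Implicit Types v : sdp_vars (R := R) T.

Let r := gamma `^ (T%:R - 1)^-1.
Let c := gamma `^ T%:R^-1.

Lemma powR_invn (n : nat) : (0 < n)%N -> (gamma `^ n%:R^-1) ^+ n = gamma.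
Proof.
move=> n0; rewrite -powR_mulrn ?powR_ge0// -powRrM mulVf ?powRr1 ?ltW//.
by rewrite pnatr_eq0 -lt0n.
Qed.

Let natr_predT : T.-1%:R = T%:R - 1 :> R.
Proof. by rewrite -subn1 natrB// ltnW. Qed.

Let r0 : 0 < r. Proof. exact: powR_gt0. Qed.
Let c0 : 0 < c. Proof. exact: powR_gt0. Qed.
Let rE : r ^+ T.-1 = gamma.
Proof. by rewrite /r -natr_predT powR_invn// -subn1 subn_gt0. Qed.
Let cE : c ^+ T = gamma. Proof. by rewrite powR_invn// ltnW. Qed.
Let r2E : gamma `^ (2 / (T%:R - 1)) = r ^+ 2.
Proof. by rewrite /r -powR_mulrn ?powR_ge0// -powRrM mulrC. Qed.

(** The constraints of the program without the equations prescribing coefficients of the curve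
    polynomial. *)
Definition sdp_cone v : Prop :=
  let n : R := T%:R in
  let alpha := sdp_alpha v in let beta := sdp_beta v in
  let g1 := sdp_gamma1 v in let g2 := sdp_gamma2 v in
  let l1 := sdp_lambda1 v in let l2 := sdp_lambda2 v in
  let l3 := sdp_lambda3 v in
  [/\ [/\ 0 <= l1, 0 <= l2, 0 <= l3, psd (sdp_P v) & psd (sdp_Q v)],
      [/\ 1 <= alpha, 0 <= g1 + g2 & 0 <= g1 + n * g2],
      [/\ l2norm2 (beta - l1) (g2 + g1 / n - alpha) <= g2 + g1 / n + alpha,
          l2norm2 (beta - l2) (g2 + g1 - alpha + 1) <= g2 + g1 + alpha - 1
        & l2norm2 (beta - l3 * n * gamma `^ n^-1)
                  (g2 + g1 / n + l3 - alpha + 1)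
          <= g2 + g1 / n + l3 + alpha - 1]
    & (forall t : nat, (t <= 2 * T)%N ->
         entry (sdp_p v) t = antidiag_sum (sdp_P v) t) /\
      (forall t : nat, (t <= 2 * T - 2)%N ->
         entry (sdp_q v) t = antidiag_sum (sdp_Q v) t)].

Definition sdp_curve v : {poly R} :=
  curve_poly T r (sdp_alpha v) (sdp_beta v) (sdp_gamma1 v) (sdp_gamma2 v).

(** Coefficientwise form of [p + X q = sdp_curve v], uniform in [T]; the guard reflects that [X q]
    has no term of degree [0] or [2 * T]. *)
Definition sdp_coef_match v : Prop := forall t : nat, (t <= 2 * T)%N ->
  entry (sdp_p v) t + (if (0 < t < 2 * T)%N then entry (sdp_q v) (t - 1) else 0)
  = (sdp_curve v)`_t.

Lemma coef_curve_poly a b g1 g2 t : (curve_poly T r a b g1 g2)`_t =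
  ((T%:R - 1) * g1 * r ^+ 2 + (T%:R - 1) ^+ 2 * g2 * r ^+ 2) * (t == 0%N)%:R
  + (T%:R - 1) * b * r * (t == 1%N)%:R + (a - 1) * (t == 2%N)%:R
  + 2 * (T%:R - 1) * g2 * r * (t == T)%:R + b * (t == T.+1)%:R
  + (g1 + g2) * (t == (2 * T)%N)%:R.
Proof.
rewrite /curve_poly !coefD !coefZ !coefXn coefX coefC.
by congr (_ + _ + _ + _ + _ + _); case: eqP; rewrite ?mulr1 ?mulr0.
Qed.

Lemma size_curve_poly a b g1 g2 : (size (curve_poly T r a b g1 g2) <= (2 * T).+1)%N.
Proof.
apply/leq_sizeP => t tT; rewrite coef_curve_poly.
by do !(rewrite (gtn_eqF (_ : _ < t)%N); last lia); rewrite !mulr0 !addr0.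
Qed.

(** The cone constraints certify the three quadratic inequalities with multipliers [l1], [l2], [l3],
    and positive semidefiniteness makes [p(z) + z q(z)] nonnegative for [z > 0]. *)
Lemma sdp_dual_feasible v : sdp_cone v -> sdp_coef_match v ->
  dual_feasible T gamma (sdp_alpha v) (sdp_beta v) (sdp_gamma1 v) (sdp_gamma2 v).
Proof.
move=> [[l10 l20 l30 Ppsd Qpsd] _ [S1 S2 S3] [pP qQ]] cm.
apply/(dual_feasibleP _ _ _ _ T2 r0 rE c0 cE); split.
- apply/quad_ge0_halflineP; exists (sdp_lambda1 v) => //.
  exact/l2norm2_leP.
- apply/quad_ge0_halflineP; exists (sdp_lambda2 v) => //.
  by apply/l2norm2_leP; move: S2; congr (l2norm2 _ _ <= _); ring.
- apply/quad_ge0_segmentP; first by rewrite mulr_gt0// ltr0n ltnW.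
  exists (sdp_lambda3 v) => //.
  by apply/l2norm2_leP; move: S3; congr (l2norm2 _ _ <= _); rewrite -?/c; ring.
move=> z z0; rewrite (horner_coef_wide z (size_curve_poly _ _ _ _)).
have leT (t : 'I_(2 * T).+1) : (t <= 2 * T)%N by rewrite -ltnS.
rewrite (eq_bigr (fun t : 'I_(2 * T).+1 => antidiag_sum (sdp_P v) t * z ^+ t +
    (if (0 < t < 2 * T)%N then entry (sdp_q v) (t - 1) else 0) * z ^+ t)); last first.
  by move=> t _; rewrite -mulrDl -pP// cm.
rewrite big_split/= addr_ge0//.
  apply: psd_antidiag_horner => // i j.
  by have := ltn_ord i; have := ltn_ord j; lia.
rewrite (@sum_shift_interior _ _ (2 * T - 2)); last by lia.
rewrite mulr_ge0 ?(ltW z0)//.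
rewrite (eq_bigr (fun t : 'I_(2 * T - 2).+1 => antidiag_sum (sdp_Q v) t * z ^+ t)).
  apply: psd_antidiag_horner => // i j.
  by have := ltn_ord i; have := ltn_ord j; lia.
by move=> t _; rewrite qQ// -ltnS.
Qed.

Lemma dual_feasible_sdp a b g1 g2 : dual_feasible T gamma a b g1 g2 ->
  exists v, [/\ sdp_cone v, sdp_coef_match v, sdp_alpha v = a, sdp_beta v = b
    & sdp_gamma1 v = g1 /\ sdp_gamma2 v = g2].
Proof.
move/(dual_feasibleP _ _ _ _ T2 r0 rE c0 cE) => [H1 H2 H3 H4].
have [l1 l10 S1] := (quad_ge0_halflineP _ _ _).2 H1.
have [l2 l20 S2] := (quad_ge0_halflineP _ _ _).2 H2.
have Tc0 : 0 < T%:R * c by rewrite mulr_gt0// ltr0n ltnW.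
have [l3 l30 S3] := (quad_ge0_segmentP _ _ _ Tc0).2 H3.
have [|[sa sb]/= [Ha Hb] DE] := @nonneg_halfline_sos _ _ _ (size_curve_poly a b g1 g2).
  move=> x; rewrite le_eqVlt => /orP[/eqP <-|/H4//].
  apply: (@horner_ge0_closure _ _ 0 0) => // y y0 yn0.
  by apply: H4; rewrite lt_def yn0.
(* The degree bound [2 * T] on the summands [a^2] and [X b^2] leaves degree at most [T] for [a] and
   [T - 1] for [b], which matches the orders of [P] and [Q]. *)
have sza p : p \in sa -> (size p <= T.+1)%N by move=> /Ha; case: (size p) => //= k; lia.
have szb p : p \in sb -> (size p <= T)%N.
  move=> pb; have [->|p0] := eqVneq p 0; first by rewrite size_poly0.
  by move: (Hb p pb p0); case: (size p) => //= k; lia.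
pose P := gram_mx T.+1 sa; pose Q := gram_mx T sb.
pose p : 'rV[R]_(2 * T).+1 := \row_t antidiag_sum P t.
pose q : 'rV[R]_(2 * T - 2).+1 := \row_t antidiag_sum Q t.
have pP t : (t <= 2 * T)%N -> entry p t = antidiag_sum P t.
  by move=> tT; rewrite /entry mxE inordK.
have qQ t : (t <= 2 * T - 2)%N -> entry q t = antidiag_sum Q t.
  by move=> tT; rewrite /entry mxE inordK.
exists (SdpVars a b g1 g2 l1 l2 l3 p P q Q); split=> //=.
- split => //=.
  + by split => //; exact: psd_gram_mx.
  (* The linear constraints are the signs of constant and leading coefficients of the nonnegative
     quadratics. *)
  + have [a0 g0 _] := S1; have [a1 g3 _] := S2; split.
    * by rewrite -subr_ge0.
    * by rewrite addrC.
    * have Tp : 0 < T%:R :> R by rewrite ltr0n ltnW.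
      rewrite -(pmulr_rge0 _ (_ : 0 < T%:R^-1)) ?invr_gt0//.
      by move: g0; congr (_ <= _); field; rewrite gt_eqF.
  + split.
    * exact/l2norm2_leP.
    * by move/l2norm2_leP : S2; congr (l2norm2 _ _ <= _); ring.
    * by move/l2norm2_leP : S3; congr (l2norm2 _ _ <= _); rewrite -?/c; ring.
- move=> t tT; rewrite /sdp_curve/= DE coefD coefXM pP// antidiag_sum_gram_mx//.
  congr (_ + _); case: t tT => [|t] tT//=.
  rewrite subn1/=; case: ltnP => tT'.
    by rewrite qQ ?antidiag_sum_gram_mx//; lia.
  (* At the top index [2 * T] the coefficient contributed by [X q] lies beyond the last antidiagonal
     of [Q]. *)
  by rewrite -(antidiag_sum_gram_mx _ szb) antidiag_sum_overflow//; lia.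
Qed.

Local Ltac simpl_coef :=
  rewrite ?eqxx; repeat (case: eqP => [?|_]; first by exfalso; lia);
  rewrite ?mulr1 ?mulr0 ?addr0 ?add0r.

(** For [T >= 3] the exponents [0, 1, 2, T, T + 1, 2 T] are distinct, so each equation of the
    program is one coefficient identity. *)
Lemma sdp_feasibleE v : (3 <= T)%N ->
  sdp_feasible gamma v <-> sdp_cone v /\ sdp_coef_match v.
Proof.
move=> T3; split.
  move=> [[C1 C2 C3 [E0 E1 E2 E3 E4] C5] E5 E6]; split=> // t tT.
  rewrite coef_curve_poly.
  have [t0|t0] := eqVneq t 0%N.
    by rewrite t0 ltnn andFb E0 r2E; simpl_coef.
  have [t1|t1] := eqVneq t 1%N.
    rewrite t1 (_ : (0 < 1 < 2 * T)%N = true); last lia.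
    by rewrite subnn E1; simpl_coef.
  have [t2|t2] := eqVneq t 2%N.
    rewrite t2 (_ : (0 < 2 < 2 * T)%N = true); last lia.
    by rewrite E5; simpl_coef.
  have [tT0|tT0] := eqVneq t T.
    rewrite tT0 (_ : (0 < T < 2 * T)%N = true); last lia.
    by rewrite E6; simpl_coef.
  have [tT1|tT1] := eqVneq t T.+1.
    rewrite tT1 (_ : (0 < T.+1 < 2 * T)%N = true); last lia.
    by rewrite addn1 in E2; rewrite subn1 E2; simpl_coef.
  have [tTT|tTT] := eqVneq t (2 * T)%N.
    by rewrite tTT ltnn andbF addr0 E3; simpl_coef.
  rewrite (_ : (0 < t < 2 * T)%N = true); last lia.
  by rewrite E4; [simpl_coef|lia].
move=> [[C1 C2 C3 C5] cm].
have cmt t : (t <= 2 * T)%N -> _ := fun tT =>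
  etrans (cm t tT) (coef_curve_poly _ _ _ _ t).
split.
- split => //; split.
  + by have := cmt 0%N (leq0n _); rewrite ltnn andFb addr0 r2E => ->; simpl_coef.
  + have := cmt 1%N; rewrite subnn (_ : (0 < 1 < 2 * T)%N = true); last lia.
    by move=> ->; [simpl_coef|lia].
  + have := cmt T.+1; rewrite (_ : (0 < T.+1 < 2 * T)%N = true); last lia.
    by rewrite subn1 addn1 => ->; [simpl_coef|lia].
  + by have := cmt (2 * T)%N (leqnn _); rewrite ltnn andbF addr0 => ->; simpl_coef.
  + move=> t Ht; have := cmt t; rewrite (_ : (0 < t < 2 * T)%N = true); last lia.
    by move=> ->; [simpl_coef|lia].
- have := cmt 2%N; rewrite (_ : (0 < 2 < 2 * T)%N = true); last lia.
  by move=> ->; [simpl_coef|lia].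
- have := cmt T; rewrite (_ : (0 < T < 2 * T)%N = true); last lia.
  by move=> ->; [simpl_coef|lia].
Qed.

(** The exponents [2] and [T] coincide, so their coefficients add up in the merged equation. *)
Lemma sdp_feasible_mergedE v : T = 2%N ->
  sdp_feasible_merged gamma v <-> sdp_cone v /\ sdp_coef_match v.
Proof.
move=> T2'; split.
  move=> [[C1 C2 C3 [E0 E1 E2 E3 E4] C5] E5]; split=> // t tT.
  rewrite coef_curve_poly.
  have [t0|t0] := eqVneq t 0%N.
    by rewrite t0 ltnn andFb E0 r2E; simpl_coef.
  have [t1|t1] := eqVneq t 1%N.
    rewrite t1 (_ : (0 < 1 < 2 * T)%N = true); last lia.
    by rewrite subnn E1; simpl_coef.
  have [t2|t2] := eqVneq t 2%N.
    rewrite t2 (_ : (0 < 2 < 2 * T)%N = true); last lia.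
    rewrite E5 (_ : (2 == T)%N = true); last lia.
    by simpl_coef.
  have [tT1|tT1] := eqVneq t T.+1.
    rewrite tT1 (_ : (0 < T.+1 < 2 * T)%N = true); last lia.
    by rewrite addn1 in E2; rewrite subn1 E2; simpl_coef.
  have -> : t = (2 * T)%N by lia.
  by rewrite ltnn andbF addr0 E3; simpl_coef.
move=> [[C1 C2 C3 C5] cm].
have cmt t : (t <= 2 * T)%N -> _ := fun tT =>
  etrans (cm t tT) (coef_curve_poly _ _ _ _ t).
split.
- split => //; split.
  + by have := cmt 0%N (leq0n _); rewrite ltnn andFb addr0 r2E => ->; simpl_coef.
  + have := cmt 1%N; rewrite subnn (_ : (0 < 1 < 2 * T)%N = true); last lia.
    by move=> ->; [simpl_coef|lia].
  + have := cmt T.+1; rewrite (_ : (0 < T.+1 < 2 * T)%N = true); last lia.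
    by rewrite subn1 addn1 => ->; [simpl_coef|lia].
  + by have := cmt (2 * T)%N (leqnn _); rewrite ltnn andbF addr0 => ->; simpl_coef.
  + by move=> t Ht; lia.
- have := cmt 2%N; rewrite (_ : (0 < 2 < 2 * T)%N = true); last lia.
  rewrite (_ : (2 == T)%N = true); last lia.
  by move=> ->; [simpl_coef|lia].
Qed.

End SdpDual.

(** * Equality of the worst-case probability and the program value *)

Section Main.
Context {R : realType} (T : nat) (mu sigma rho gamma : R).
Hypotheses (hT : (2 <= T)%N) (hmu : 0 < mu) (hsigma : 0 < sigma)
  (hrho_gt : - (1 / (T%:R - 1)) < rho) (hrho_lt : rho < 1)
  (hmoment : 0 < mu ^+ 2 + rho * sigma ^+ 2) (hgamma : 0 < gamma).

Let M1 : R := T%:R * mu.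
Let M2 : R := T%:R * (mu ^+ 2 + sigma ^+ 2).
Let M3 : R :=
  T%:R * (T%:R * mu ^+ 2 + sigma ^+ 2 + (T%:R - 1) * rho * sigma ^+ 2).

Lemma moments_interior : [/\ 0 < M1, M1 ^+ 2 < M3, M3 < T%:R * M2 & M2 < M3].
(* The gaps are [T sigma^2 (1 + (T - 1) rho)], [T (T - 1) sigma^2 (1 - rho)] and
   [T (T - 1) (mu^2 + rho sigma^2)]: the lower and upper bounds on [rho] and the condition on
   [mu^2 + rho sigma^2] each give one inequality. *)
Proof.
have Tp : 0 < T%:R :> R by rewrite ltr0n ltnW.
have T1p : 0 < T%:R - 1 :> R by rewrite subr_gt0 ltr1n.
have s2 : 0 < sigma ^+ 2 by rewrite exprn_gt0.
split.
- by rewrite mulr_gt0.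
- rewrite -subr_gt0 [ltRHS](_ : _ = T%:R * (sigma ^+ 2 * (1 + (T%:R - 1) * rho))).
    rewrite !mulr_gt0//; move: hrho_gt.
    by rewrite -(ltr_pM2l T1p) mulrN mulrA mulr1 divff ?gt_eqF//; lra.
  by rewrite /M3 /M1; ring.
- rewrite -subr_gt0 [ltRHS](_ : _ = T%:R * ((T%:R - 1) * (sigma ^+ 2 * (1 - rho)))).
    by rewrite !mulr_gt0// subr_gt0.
  by rewrite /M3 /M2; ring.
- rewrite -subr_gt0 [ltRHS](_ : _ = T%:R * ((T%:R - 1) * (mu ^+ 2 + rho * sigma ^+ 2))).
    by rewrite !mulr_gt0.
  by rewrite /M3 /M2; ring.
Qed.

Lemma worst_case_prob_sdp_value (F : set (sdp_vars (R := R) T)) :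
  (forall v, F v <-> sdp_cone gamma v /\ sdp_coef_match gamma v) ->
  worst_case_prob T mu sigma rho gamma = sdp_value mu sigma rho F.
Proof.
move=> FE; have [M10 M13 M32 M23] := moments_interior.
apply/eqP; rewrite eq_le; apply/andP; split.
  apply: ge_ereal_sup => _ [P Pamb <-]; apply: le_ereal_inf_tmp => _ [v /FE[vc vm] <-].
  exact: (weak_duality Pamb (sdp_dual_feasible hT hgamma vc vm)).
have primal (l : seq ({nonneg R} * outcome R T)) : feasible_atoms M1 M2 M3 l ->
    ((moment l (fun x => (\prod_i x i <= gamma)%R%:R))%:E <=
     worst_case_prob T mu sigma rho gamma)%E.
  move=> [[l0 l1] m1 m2 m3].
  have [P Pamb <-] := symmetrize_ambiguity_set gamma hT l0 l1 m1 m2 m3.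
  by apply: ereal_sup_ubound; exists P.
have wfin : worst_case_prob T mu sigma rho gamma \is a fin_num.
  have [[l /primal lw] _] := feasible_atoms_interior hT M10 M13 M32 M23.
  rewrite fin_numE; apply/andP; split.
    by apply: contraTneq lw => ->; rewrite -ltNge ltNyr.
  rewrite -ltey; apply: (@le_lt_trans _ _ 1%E); last exact: ltry.
  apply: ge_ereal_sup => _ [P _ <-]; apply: probability_le1.
  exact: measurable_prod_le.
(* Strong duality needs a level strictly above all attainable probabilities, so it is applied to the
   finite supremum plus [e], for every [e > 0]. *)
rewrite -(fineK wfin); apply/lee_addgt0Pr => e e0; rewrite -EFinD.
have [|a [b [g1 [g2 [df <-]]]]] := @strong_duality R T M1 M2 M3 hT M10 M13 M32 M23
    gamma (fine (worst_case_prob T mu sigma rho gamma) + e).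
  move=> l /primal; rewrite -{1}(fineK wfin) lee_fin => /le_lt_trans; apply.
  by rewrite ltrDl.
have [v [vc vm va vb [vg1 vg2]]] := dual_feasible_sdp hT hgamma df.
apply: ereal_inf_lbound; exists v; first exact/FE.
by rewrite /sdp_objective va vb vg1 vg2.
Qed.

End Main.

Theorem theorem3p1 (R : realType) (T : nat) (mu sigma rho gamma : R)
  (hT : (2 <= T)%N) (hmu : 0 < mu) (hsigma : 0 < sigma)
  (hrho_gt : - (1 / (T%:R - 1)) < rho) (hrho_lt : rho < 1)
  (hmoment : 0 < mu ^+ 2 + rho * sigma ^+ 2) (hgamma : 0 < gamma) :
  ((3 <= T)%N ->
     worst_case_prob T mu sigma rho gamma =
     sdp_value mu sigma rho (@sdp_feasible R T gamma)) /\
  (T = 2%N ->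
     worst_case_prob T mu sigma rho gamma =
     sdp_value mu sigma rho (@sdp_feasible_merged R T gamma)).
Proof.
split=> T3; apply: worst_case_prob_sdp_value => // v.
- exact: sdp_feasibleE.
- exact: sdp_feasible_mergedE.
Qed.
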